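(* Let $\Gamma$ be a countable, discrete group. The following are equivalent: i) $\Gamma$ is a-T-menable; ii) for every real $p\geq 1$, the group $\Gamma$ acts properly isometrically on some $L^p$-space.
   Context: A locally compact $\sigma$-compact group is a-T-menable if it acts properly by affine isometries on some Hilbert space. An affine isometric action $\alpha$ of $G$ on a Banach space $V$ is proper if $\|\alpha(g)v\|\to\infty$ as $g\to\infty$ for some (equivalently every) $v\in V$. An $L^p$-space is a Banach space $L^p(\Omega,\nu)$ for a measure space $(\Omega,\nu)$; isometric actions on it are understood to be affine isometric actions. *)

(* Defs.v *)
From HB Require Import structures.
From mathcomp Require Import all_boot all_order all_algebra.
From mathcomp Require Import all_classical all_reals all_analysis.
From mathcomp Require Import measurable_realfun ess_sup_inf.

Set Implicit Arguments.
Unset Strict Implicit.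
Unset Printing Implicit Defensive.

Import Order.TTheory GRing.Theory Num.Theory.
Import numFieldNormedType.Exports.

Local Open Scope classical_set_scope.
Local Open Scope ring_scope.

(** The library's [LspaceType mu p1] is the set of a.e.-classes of real
    functions with finite L^p norm, without any algebraic structure; it is made
    here into a normed space. *)
Section LspaceNormed.
Context d (T : measurableType d) (R : realType).
Variables (mu : {measure set T -> \bar R}) (p : \bar R) (p1 : (1 <= p)%E).

Local Notation Lf := (LfunType mu p1).
Local Notation Lp := (LspaceType mu p1).
Local Notation Q := {mfun_ mu, T >-> measurableTypeR R}.
Local Open Scope quotient_scope.

Lemma ae_eq_Lnorm (f g : T -> \bar R) : measurable_fun setT f ->
  measurable_fun setT g -> f = g %[ae mu] -> Lnorm mu p f = Lnorm mu p g.
Proof.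
move=> mf mg fg; rewrite unlock /Lnorm; case: p p1 => [r| |]//= r1.
- have mp (h : T -> \bar R) : measurable_fun setT h ->
      measurable_fun setT (fun x => `|h x| `^ r)%E.
    move=> mh; apply: (measurableT_comp (measurable_poweR _)) => //.
    exact: measurableT_comp.
  congr (_ `^ _)%E; apply: ge0_ae_eq_integral => //; [exact: mp|exact: mp| | |].
  + by move=> x _; exact: poweR_ge0.
  + by move=> x _; exact: poweR_ge0.
  + by apply: filterS fg => x /(_ I) + _ => ->.
- case: ifPn => // _; apply: eq_ess_sup.
  by apply: filterS fg => x /(_ I) /= ->.
Qed.

Let mLf (f : {mfun T >-> measurableTypeR R}) :
  measurable_fun [set: T] (EFin \o f).
Proof. by apply/measurable_EFinP; exact: (measurable_funPT f). Qed.

Section Class.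
Variable f : Lf.

Let g : T -> measurableTypeR R := f.

Let g_measurable : measurable_fun [set: T] g.
Proof. exact: (measurable_funPT f). Qed.

HB.instance Definition _ :=
  isMeasurableFun.Build d _ T (measurableTypeR R) g g_measurable.

Let c : Q := \pi_Q (g : {mfun T >-> measurableTypeR R}).

Let c_ae : (c : T -> R) = f %[ae mu].
Proof.
have /eqmodP/asboolP := reprK c; exact.
Qed.

Let c_finite : finite_norm mu p c.
Proof.
rewrite /finite_norm (@ae_eq_Lnorm _ (EFin \o f)).
- exact: Lfunction_finite.
- exact: mLf.
- exact: (mLf g).
- by apply: filterS c_ae => x /(_ I) /= ->.
Qed.

HB.instance Definition _ := @isFinLebesgue.Build d T R mu p p1 c c_finite.

Definition Lclass : Lp := c.

Lemma Lclass_ae :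
  ((Lclass : Q) : T -> R) = f %[ae mu].
Proof. exact: c_ae. Qed.
End Class.

Section Repr.
Variable f : Lp.

Let g : T -> R := (f : Q).

Let g_measurable : measurable_fun [set: T] g.
Proof. exact: (measurable_funPT (repr (f : Q))). Qed.

HB.instance Definition _ := isMeasurableFun.Build d _ T R g g_measurable.

Let g_finite : finite_norm mu p g.
Proof. exact: Lebesgue_finite. Qed.

HB.instance Definition _ := @isLfunction.Build d T R mu p p1 g g_finite.

Definition Lrepr : Lf := g.
End Repr.

Lemma LclassK_ae (f : Lf) : (Lrepr (Lclass f) : T -> R) = f %[ae mu].
Proof. exact: Lclass_ae. Qed.

Lemma Lspace_eqP (f g : Lp) :
  f = g <-> (Lrepr f : T -> R) = Lrepr g %[ae mu].
Proof.
split=> [->|fg]; first exact: ae_eq_refl.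
have : (f : Q) = g.
  by rewrite -[LHS]reprK -[RHS]reprK; apply/eqmodP/asboolP.
case: f g {fg} => f [[fP]] [g [[gP]]] /= fg.
by move: fg gP => <- gP; rewrite (bool_irrelevance fP gP).
Qed.

Lemma Lclass_eqP (f g : Lf) :
  Lclass f = Lclass g <-> (f : T -> R) = g %[ae mu].
Proof.
split=> [fg|fg].
  apply: ae_eq_trans (LclassK_ae g); rewrite -fg.
  exact/ae_eq_sym/LclassK_ae.
apply/Lspace_eqP; apply: (ae_eq_trans (LclassK_ae f)).
by apply: (ae_eq_trans fg); exact/ae_eq_sym/LclassK_ae.
Qed.

Lemma LreprK : cancel Lrepr Lclass.
Proof. by move=> f; apply/Lspace_eqP; exact: LclassK_ae. Qed.

HB.instance Definition _ := gen_eqMixin Lp.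
HB.instance Definition _ := gen_choiceMixin Lp.

Let Ladd (f g : Lp) := Lclass (Lrepr f + Lrepr g).
Let Lopp (f : Lp) := Lclass (- Lrepr f).
Let Lscale (a : R) (f : Lp) := Lclass (a *: Lrepr f).

Let LaddE (f g : Lf) : Ladd (Lclass f) (Lclass g) = Lclass (f + g).
Proof.
apply/Lclass_eqP; have := LclassK_ae g; have := LclassK_ae f.
by apply: filterS2 => x /(_ I) fx /(_ I) gx _; exact: (congr2 +%R fx gx).
Qed.

Let LoppE (f : Lf) : Lopp (Lclass f) = Lclass (- f).
Proof.
apply/Lclass_eqP; have := LclassK_ae f.
by apply: filterS => x /(_ I) fx _; exact: (congr1 -%R fx).
Qed.

Let LscaleE a (f : Lf) : Lscale a (Lclass f) = Lclass (a *: f).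
Proof.
apply/Lclass_eqP; have := LclassK_ae f.
by apply: filterS => x /(_ I) fx _; exact: (congr1 ( *%R a) fx).
Qed.

Let LaddA : associative Ladd.
Proof.
by move=> f g h; rewrite -(LreprK f) -(LreprK g) -(LreprK h) !LaddE addrA.
Qed.

Let LaddC : commutative Ladd.
Proof. by move=> f g; rewrite /Ladd addrC. Qed.

Let Ladd0 : left_id (Lclass 0) Ladd.
Proof. by move=> f; rewrite -(LreprK f) LaddE add0r. Qed.

Let LaddN : left_inverse (Lclass 0) Lopp Ladd.
Proof. by move=> f; rewrite -(LreprK f) LoppE LaddE addNr. Qed.

HB.instance Definition _ :=
  GRing.isZmodule.Build Lp LaddA LaddC Ladd0 LaddN.

Let LscaleA a b (f : Lp) : Lscale a (Lscale b f) = Lscale (a * b) f.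
Proof. by rewrite -(LreprK f) !LscaleE scalerA. Qed.

Let Lscale1 : left_id 1 Lscale.
Proof. by move=> f; rewrite -(LreprK f) LscaleE scale1r. Qed.

Let LscaleDr : right_distributive Lscale Ladd.
Proof.
move=> a f g; rewrite -(LreprK f) -(LreprK g).
by rewrite LaddE !LscaleE LaddE scalerDr.
Qed.

Let LscaleDl (f : Lp) a b : Lscale (a + b) f = Ladd (Lscale a f) (Lscale b f).
Proof. by rewrite -(LreprK f) !LscaleE LaddE scalerDl. Qed.

HB.instance Definition _ :=
  GRing.Zmodule_isLmodule.Build R Lp LscaleA Lscale1 LscaleDr LscaleDl.

Lemma LclassD (f g : Lf) : Lclass (f + g) = Lclass f + Lclass g.
Proof. by rewrite -LaddE. Qed.

Lemma LclassZ a (f : Lf) : Lclass (a *: f) = a *: Lclass f.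
Proof. by rewrite -LscaleE. Qed.

Let Lspace_norm (f : Lp) : R := fine (Lnorm mu p (EFin \o Lrepr f)).

Let Lspace_normE (f : Lf) :
  Lspace_norm (Lclass f) = fine (Lnorm mu p (EFin \o f)).
Proof.
congr fine; apply: ae_eq_Lnorm.
- by apply/measurable_EFinP; exact: measurable_funPT.
- by apply/measurable_EFinP; exact: measurable_funPT.
- by apply: filterS (LclassK_ae f) => x /(_ I) /= ->.
Qed.

Let Lspace_normD (f g : Lp) :
  Lspace_norm (f + g) <= Lspace_norm f + Lspace_norm g.
Proof.
rewrite -(LreprK f) -(LreprK g) -LclassD !Lspace_normE.
exact: ler_LnormD.
Qed.

Let Lspace_normZ a (f : Lp) : Lspace_norm (a *: f) = `|a| * Lspace_norm f.
Proof.
rewrite -(LreprK f) -LclassZ !Lspace_normE.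
by apply: EFin_inj; rewrite EFinM !finite_norm_fine LnormZ.
Qed.

Let Lspace_norm0 (f : Lp) : Lspace_norm f = 0 -> f = 0.
Proof.
rewrite -(LreprK f) Lspace_normE => /fine_Lnormr_eq0 f0.
exact/Lclass_eqP.
Qed.

HB.instance Definition _ :=
  Lmodule_isNormed.Build R Lp Lspace_normD Lspace_normZ Lspace_norm0.

Lemma Lspace_normrE (f : Lp) : `|f| = fine (Lnorm mu p (EFin \o (f : Q))).
Proof. by []. Qed.
End LspaceNormed.

Section AffineIsometricActions.
Context (R : realType) (G : groupType).

Definition affine_isometry (V : normedModType R) (f : V -> V) :=
  (exists (l : {linear V -> V}) (b : V), forall v, f v = l v + b) /\
  (forall u v, `|f u - f v| = `|u - v|).

(** [G] is discrete, so no continuity of [g |-> alpha g v] is required. *)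
Definition affine_isometric_action (V : normedModType R) (alpha : G -> V -> V) :=
  [/\ forall v, alpha 1%g v = v,
      forall g h v, alpha (g * h)%g v = alpha g (alpha h v) &
      forall g, affine_isometry (alpha g)].

(** The compact subsets of a discrete group are the finite ones. *)
Definition group_infinity : set_system G := [set A | cofinite_set A].

Definition proper_action (V : normedModType R) (alpha : G -> V -> V) :=
  exists v : V, `|alpha g v| @[g --> group_infinity] --> +oo.

Definition acts_properly_isometrically (V : normedModType R) :=
  exists alpha : G -> V -> V, affine_isometric_action alpha /\ proper_action alpha.

(** A real Hilbert space: a Banach space whose norm comes from an inner product. *)
Definition hilbert_space (V : completeNormedModType R) :=
  exists dot : {dot V for idfun}, forall v, `|v| ^+ 2 = dot v v.

Definition a_T_menable :=
  exists H : completeNormedModType R,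
    hilbert_space H /\ acts_properly_isometrically H.

Definition acts_properly_on_some_Lp (p : R) (p1 : (1 <= p%:E)%E) :=
  exists (d : measure_display) (T : measurableType d)
    (mu : {measure set T -> \bar R}),
    acts_properly_isometrically (LspaceType mu p1).
End AffineIsometricActions.

(* Main.v *)
Require Import Defs.
From HB Require Import structures.
From mathcomp Require Import all_boot all_order all_algebra.
From mathcomp Require Import all_classical all_reals all_analysis.
From mathcomp Require Import measurable_realfun ring lra zify.

(** A proper action on some L^2 is a proper action on a Hilbert space, by the
    Riesz-Fischer theorem ([L2_complete], from [Lnorm_cauchy_limit]).

    Conversely let x_g be an orbit of a proper affine isometric action on a
    Hilbert space H, and fix p. The kernel exp(-t |x_g - x_h|^2) is
    positive definite and invariant. One would like to realise it as the
    correlation of a stationary process (X_g) of bounded variables on a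
    probability space on which the group acts by measure-preserving maps. The
    classical choice is X_g = cos(W(x_g) + theta), with W a Gaussian process
    indexed by H and theta a uniform independent phase, which makes the law
    invariant under all affine isometries of H. Then the differences X_h - X_1
    have variance 1 - exp(-t |x_h - x_1|^2), which is small for t small, h
    fixed, and bounded below for h large, t fixed. Being bounded, they satisfy
    the same estimates in L^p, for every p. Summing over a sequence of values of
    t that tends to zero, that is, letting F be the function X_1 on
    a disjoint union of countably many such spaces, the functions
    F o h - F are in L^p and their norms tend to infinity with h:
    f |-> (f + F) o h - F is the required action ([cocycle_action_proper]).

    The process itself can be replaced by coin tosses: for each g toss countably
    many coins with values +1 and -1, independent given the process, of
    expectation X_g. The probability that finitely many coins fall in a prescribed
    way is the expectation of a product of factors (1 +- cos(W(x_g) + theta)) / 2,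
    a trigonometric polynomial, hence is an explicit combination ([twist]) of
    values of the function (u, k) |-> [k = 0] exp(-t |u|^2) on the group H x Z,
    where k is the degree in the phase. It is nonnegative since that function is
    of positive type ([gaussian_pos_def], by Schur's product theorem) and since
    each factor is a square ([pos_def_twist1]). These consistent finite laws
    are realised on the unit interval by nested intervals
    ([bit_process_exists]), and transported to the space of families of bits
    indexed by pairs (g, j), on which the group acts by translation of g. The
    measure is invariant because the combinations are
    ([bit_law_invariant], [bit_measure_relabel]). Finally X_g is replaced by the
    average of m of its coins, which adds 1/m to the variance
    ([bit_average_variance]); m = 4^n and t = 4^-n in the n-th copy make the
    L^p norms finite ([increment_moment_le]) and proper
    ([increment_moment_ge]). *)

Set Implicit Arguments.
Unset Strict Implicit.
Unset Printing Implicit Defensive.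

Import Order.TTheory GRing.Theory Num.Theory.
Import numFieldNormedType.Exports.

Local Open Scope classical_set_scope.
Local Open Scope ring_scope.

(** * Positive semidefinite kernels and Schur's product theorem *)

Definition psd (R : realFieldType) (J : finType) (K : J -> J -> R) :=
  forall c : J -> R, 0 <= \sum_a \sum_b c a * c b * K a b.

Section PsdKernels.
Context (R : realFieldType) (J : finType).
Implicit Types (K : J -> J -> R) (c : J -> R).

Lemma psd_diag_ge0 K a : psd K -> 0 <= K a a.
Proof.
move=> /(_ (fun x => (x == a)%:R)); rewrite (bigD1 a)//= eqxx.
rewrite (bigD1 a)//= eqxx !mul1r !big1 ?addr0//.
- by move=> i /negPf ia; rewrite big1// => j _; rewrite ia !mul0r.
- by move=> i /negPf ia; rewrite ia mulr0 mul0r.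
Qed.

Lemma quadratic_form_shift K c a t : (forall x y, K x y = K y x) ->
  let c' x := c x + t * (x == a)%:R in
  \sum_x \sum_y c' x * c' y * K x y =
    \sum_x \sum_y c x * c y * K x y + 2 * t * (\sum_x c x * K x a)
      + t ^+ 2 * K a a.
Proof.
move=> Ksym c'.
have delta (f : J -> R) : \sum_x (x == a)%:R * f x = f a.
  rewrite (bigD1 a)//= eqxx mul1r big1 ?addr0// => i /negPf ->.
  by rewrite mul0r.
transitivity (\sum_x (\sum_y c x * c y * K x y + t * (c x * K x a)
   + (x == a)%:R * (t * (\sum_y c y * K x y) + t ^+ 2 * K x a))).
  apply: eq_bigr => x _.
  transitivity (\sum_y (c x * c y * K x y + (y == a)%:R * (t * (c x * K x y))
      + (t * (x == a)%:R) * (c y * K x y)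
      + (y == a)%:R * (t ^+ 2 * (x == a)%:R * K x y))).
    by apply: eq_bigr => y _; rewrite /c'; ring.
  by rewrite !big_split/= !delta -mulr_sumr; ring.
rewrite !big_split/= delta -mulr_sumr.
have -> : \sum_y c y * K a y = \sum_x c x * K x a.
  by apply: eq_bigr => y _; rewrite Ksym.
by ring.
Qed.

(** Otherwise the quadratic form would be affine and nonconstant along the
    direction [a], hence negative somewhere. *)
Lemma psd_diag_eq0 K a b : (forall x y, K x y = K y x) -> psd K ->
  K a a = 0 -> K b a = 0.
Proof.
move=> Ksym Kpsd Kaa; apply/eqP/negPn/negP => Kba.
pose c x : R := (x == b)%:R.
have := Kpsd (fun x => c x + (- (K b b + 1) / (2 * K b a)) * (x == a)%:R).
rewrite quadratic_form_shift// Kaa mulr0 addr0.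
have delta (f : J -> R) : \sum_x c x * f x = f b.
  rewrite /c (bigD1 b)//= eqxx mul1r big1 ?addr0// => i /negPf ->.
  by rewrite mul0r.
under eq_bigr do under eq_bigr do rewrite -mulrA.
under eq_bigr do rewrite -mulr_sumr delta.
rewrite !delta.
have -> : 2 * (- (K b b + 1) / (2 * K b a)) * K b a = - (K b b + 1).
  by field.
by rewrite leNgt; apply/negP; rewrite negbK; lra.
Qed.

(** Subtracting this rank-one kernel amounts to minimising the quadratic form
    along the direction [a]; the row and the column of [a] become zero. *)
Lemma psd_schur_complement K a : (forall x y, K x y = K y x) -> psd K ->
  psd (fun x y => K x y - K x a * K y a / K a a).
Proof.
move=> Ksym Kpsd c.
have [Kaa|Kaa] := eqVneq (K a a) 0.
  have /le_trans := Kpsd c; apply; rewrite le_eqVlt; apply/orP; left; apply/eqP.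
  by apply: eq_bigr => x _; apply: eq_bigr => y _; rewrite Kaa invr0 mulr0 subr0.
set s := \sum_x c x * K x a.
have := Kpsd (fun x => c x + (- s / K a a) * (x == a)%:R).
rewrite quadratic_form_shift// -/s => /le_trans; apply.
rewrite le_eqVlt; apply/orP; left; apply/eqP.
transitivity (\sum_x \sum_y c x * c y * K x y - s * s / K a a); first by field.
rewrite -mulrA {1}/s mulr_suml -sumrB; apply: eq_bigr => x _.
rewrite /s mulr_suml mulr_sumr -sumrB; apply: eq_bigr => y _.
by ring.
Qed.

End PsdKernels.

Section SchurProduct.
Context (R : realFieldType) (H : lmodType R) (dot : {dot H for idfun}).
Context (J : finType).

Lemma dot_sym u v : dot u v = dot v u.
Proof. by rewrite hermC expr0 mul1r. Qed.

Lemma dot_ge0 u : 0 <= dot u u.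
Proof.
have [->|/neq0_dnorm_gt0/ltW] := eqVneq u 0; last exact.
by rewrite linear0l.
Qed.

Lemma dot_sumlr (u v : J -> H) :
  dot (\sum_a u a) (\sum_b v b) = \sum_a \sum_b dot (u a) (v b).
Proof. by rewrite linear_sumlz; apply: eq_bigr => a _; rewrite linear_sumr. Qed.

Lemma dotZZ a b u v : dot (a *: u) (b *: v) = a * b * dot u v.
Proof. by rewrite linearZl_LR linearZr_LR/= mulrA. Qed.

(** By Schur complements [K] is a sum of rank-one kernels [f a * f b], and each
    of them contributes the squared norm of [\sum_a f a *: u a]. The induction
    is on the number of nonzero diagonal entries. *)
Lemma psd_dot (K : J -> J -> R) (u : J -> H) :
  (forall x y, K x y = K y x) -> psd K ->
  0 <= \sum_a \sum_b K a b * dot (u a) (u b).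
Proof.
have [n] := ubnP #|[pred a | K a a != 0]|; elim: n K => // n IH K Kn Ksym Kpsd.
have [/existsP[a0 Ka0]|/existsPn Kdiag0] := boolP [exists a, K a a != 0].
  pose K' x y := K x y - K x a0 * K y a0 / K a0 a0.
  have K'sym x y : K' x y = K' y x by rewrite /K' Ksym; ring.
  have K'psd : psd K' by exact: psd_schur_complement.
  have sub : \sum_a \sum_b K a b * dot (u a) (u b) =
      \sum_a \sum_b K' a b * dot (u a) (u b) +
      dot (\sum_a K a a0 *: u a) (\sum_a K a a0 *: u a) / K a0 a0.
    rewrite dot_sumlr mulr_suml -big_split; apply: eq_bigr => a _ /=.
    rewrite mulr_suml -big_split; apply: eq_bigr => b _ /=.
    by rewrite dotZZ /K'; field.
  rewrite sub addr_ge0//; last first.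
    by rewrite divr_ge0 ?dot_ge0// psd_diag_ge0.
  apply: IH => //; apply: (leq_trans _ (Kn : #|_| <= n)%N).
  apply: proper_card; apply/properP; split.
    apply/fintype.subsetP => x; rewrite !inE; apply: contraNN => /eqP Kxx.
    have Kxa : K a0 x = 0 by exact: psd_diag_eq0.
    by rewrite /K' Kxx (Ksym x) Kxa !mul0r subr0.
  exists a0; rewrite !inE//= /K' negbK.
  by apply/eqP; field.
have K0 a b : K a b = 0.
  by apply: psd_diag_eq0 => //; apply/eqP; move: (Kdiag0 b); rewrite negbK.
by rewrite big1// => a _; rewrite big1// => b _; rewrite K0 mul0r.
Qed.

(** Schur's product theorem, for a Gram matrix as second factor. *)
Lemma psd_mul_gram (K : J -> J -> R) (u : J -> H) :
  (forall x y, K x y = K y x) -> psd K ->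
  psd (fun a b => K a b * dot (u a) (u b)).
Proof.
move=> Ksym Kpsd c; have := psd_dot (fun a => c a *: u a) Ksym Kpsd.
move=> /le_trans; apply; rewrite le_eqVlt; apply/orP; left; apply/eqP.
by apply: eq_bigr => a _; apply: eq_bigr => b _; rewrite dotZZ; ring.
Qed.

Lemma psd_mul_gramX (K : J -> J -> R) (u : J -> H) n :
  (forall x y, K x y = K y x) -> psd K ->
  psd (fun a b => K a b * dot (u a) (u b) ^+ n).
Proof.
move=> Ksym Kpsd; elim: n => [|n IH].
  by move=> c; under eq_bigr do under eq_bigr do rewrite expr0 mulr1.
move=> c; under eq_bigr do under eq_bigr do rewrite exprSr (mulrA (K _ _)).
apply: (@psd_mul_gram (fun a b => K a b * dot (u a) (u b) ^+ n)) => // x y.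
by rewrite Ksym dot_sym.
Qed.

End SchurProduct.

(** * Gaussian functions of positive type, and random coins *)

Definition pos_def (R : realFieldType) (V : zmodType) (phi : V -> R) :=
  forall l : seq (V * R),
    0 <= \sum_(x <- l) \sum_(y <- l) x.2 * y.2 * phi (x.1 - y.1).

Definition sg (R : realFieldType) (b : bool) : R := if b then 1 else -1.

Section GaussianKernel.
Context (R : realType) (H : lmodType R) (dot : {dot H for idfun}).

(** The second component is the degree with respect to a random phase common
    to all vectors: the phase kills every character of nonzero degree, which is
    what makes the later constructions insensitive to translations of [H]. *)
Definition gaussian (t : R) (v : (H * int)%type) : R :=
  (v.2 == 0)%:R * expR (- (t * dot v.1 v.1)).

(** The quadratic form of such a kernel is the sum of the squares of the masses
    of the fibres of [k]. *)
Lemma psd_eq (J : finType) (T : eqType) (k : J -> T) :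
  psd (fun a b => (k a == k b)%:R : R).
Proof.
move=> c; have -> : \sum_a \sum_b c a * c b * (k a == k b)%:R =
    \sum_(z <- undup (codom k)) (\sum_a c a * (k a == z)%:R) ^+ 2.
  have sqrE z : (\sum_a c a * (k a == z)%:R) ^+ 2 =
      \sum_a \sum_b (c a * (k a == z)%:R) * (c b * (k b == z)%:R).
    by rewrite expr2 mulr_suml; apply: eq_bigr => a _; rewrite mulr_sumr.
  under [RHS]eq_bigr do rewrite sqrE.
  rewrite [RHS]exchange_big; apply: eq_bigr => a _.
  rewrite [RHS]exchange_big; apply: eq_bigr => b _.
  rewrite (bigD1_seq (k a)) ?undup_uniq ?mem_undup ?codom_f//= eqxx mulr1.
  rewrite big1 ?addr0 => [|z /negPf za]; first by rewrite eq_sym mulrA.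
  by rewrite (eq_sym (k a)) za !(mulr0, mul0r).
by apply: sumr_ge0 => z _; exact: sqr_ge0.
Qed.

(** The exponential is a power series with nonnegative coefficients, and the
    powers are dealt with by Schur's theorem. *)
Lemma psd_mul_exp_gram (J : finType) (K : J -> J -> R) (u : J -> H) (t : R) :
  0 <= t -> (forall x y, K x y = K y x) -> psd K ->
  psd (fun a b => K a b * expR (t * dot (u a) (u b))).
Proof.
move=> t0 Ksym Kpsd c.
pose f n := \sum_a \sum_b
  c a * c b * (K a b * series (exp_coeff (t * dot (u a) (u b))) n).
have f_ge0 n : 0 <= f n.
  have -> : f n = \sum_(0 <= k < n) t ^+ k / k`!%:R *
      \sum_a \sum_b c a * c b * (K a b * dot (u a) (u b) ^+ k).
    under [RHS]eq_bigr do rewrite mulr_sumr.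
    rewrite [RHS]exchange_big; apply: eq_bigr => a _.
    under [RHS]eq_bigr do rewrite mulr_sumr.
    rewrite [RHS]exchange_big; apply: eq_bigr => b _.
    rewrite /series /= !mulr_sumr; apply: eq_bigr => k _.
    by rewrite /exp_coeff /= exprMn; ring.
  apply: sumr_ge0 => k _; rewrite mulr_ge0//.
    by rewrite divr_ge0// exprn_ge0.
  exact: psd_mul_gramX.
have cvgf : (f n @[n --> \oo] --> \sum_a \sum_b
    c a * c b * (K a b * expR (t * dot (u a) (u b))))%classic.
  apply: cvg_big => [|a _]; first exact: add_continuous.
  apply: cvg_big => [|b _]; first exact: add_continuous.
  apply: cvgMl_tmp; apply: cvgMl_tmp; exact: is_cvg_series_exp_coeff.
rewrite -(cvg_lim _ cvgf)//; apply: limr_ge.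
  by apply/cvg_ex; eexists; exact: cvgf.
by near=> n.
Unshelve. all: by end_near. Qed.

(** As $|u - w|^2 = |u|^2 + |w|^2 - 2 <u, w>$, the Gaussian is the product of a
    rank-one kernel and of the exponential of a Gram matrix. *)
Lemma gaussian_pos_def t : 0 <= t -> pos_def (gaussian t).
Proof.
move=> t0 l; rewrite (big_nth (0, 0)) big_mkord.
under eq_bigr do rewrite (big_nth (0, 0)) big_mkord.
pose w (i : 'I_(size l)) := nth (0, 0) l i.
pose u i := (w i).1.1; pose k i := (w i).1.2.
have := @psd_mul_exp_gram _ (fun a b => (k a == k b)%:R) u (2 * t).
move=> /(_ (mulr_ge0 (ler0n _ _) t0)).
move=> /(_ (fun x y => congr1 _ (congr1 _ (eq_sym _ _))) (psd_eq k)).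
move=> /(_ (fun a => (w a).2 * expR (- (t * dot (u a) (u a))))).
move=> /le_trans; apply; rewrite le_eqVlt; apply/orP; left; apply/eqP.
apply: eq_bigr => a _; apply: eq_bigr => b _.
rewrite -/(w a) -/(w b) /gaussian /= subr_eq0 -/(k a) -/(k b) -/(u a) -/(u b).
rewrite linearBl !linearBr/= (dot_sym dot (u b) (u a)).
have -> (x y z : R) : - (t * x - t * y - (t * y - t * z)) =
    - (t * x) + - (t * z) + 2 * t * y.
  by ring.
by rewrite !expRD; ring.
Qed.

Lemma gaussian0 t : gaussian t 0 = 1.
Proof. by rewrite /gaussian/= linear0l mulr0 oppr0 expR0 mulr1. Qed.

End GaussianKernel.

Section Twist.
Context (R : realFieldType) (V : zmodType).
Implicit Types (phi : V -> R) (v : V) (b : bool) (l : seq (V * bool)).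

(** If [phi] is thought of as the Fourier transform of a probability measure on
    characters [chi] of [V], then [twist1 v b phi] is the Fourier transform of
    that measure multiplied by the density (1 + sg b * Re (chi v)) / 2, the
    probability that a coin with values +1 and -1, of expectation Re (chi v),
    falls on the side [b]. Hence [twist phi l 0] is the probability that such
    coins, independent given a random [chi], fall as prescribed by [l]. *)
Definition twist1 v b phi u : R :=
  (2 * phi u + sg R b * (phi (u + v) + phi (u - v))) / 4.

Fixpoint twist phi l : V -> R :=
  if l is (v, b) :: l' then twist1 v b (twist phi l') else phi.

(** The density is the square |1 + sg b * chi v|^2 / 4, so that the quadratic
    form of [twist1 v b phi] is that of [phi] on a family of twice the size. *)
Lemma pos_def_twist1 phi v b : pos_def phi -> pos_def (twist1 v b phi).
Proof.
move=> pd l.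
have := pd (l ++ [seq (x.1 + v, sg R b * x.2) | x <- l]).
rewrite big_cat/= big_map/=.
under eq_bigr do rewrite big_cat big_map/=.
under [X in _ + X]eq_bigr do rewrite big_cat big_map/=.
rewrite -big_split/= => /(mulr_ge0 (_ : 0 <= 4^-1)).
rewrite invr_ge0 ler0n => /(_ isT) /le_trans; apply.
rewrite le_eqVlt; apply/orP; left; apply/eqP.
rewrite mulr_sumr; apply: eq_bigr => x _.
rewrite -!big_split/= mulr_sumr; apply: eq_bigr => y _.
rewrite /twist1 (_ : x.1 - (y.1 + v) = x.1 - y.1 - v); last by rewrite opprD addrA.
rewrite (_ : x.1 + v - (y.1 + v) = x.1 - y.1); last by rewrite opprD addrACA subrr addr0.
rewrite (_ : x.1 + v - y.1 = x.1 - y.1 + v); last by rewrite addrAC.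
by case: b; rewrite /sg; field.
Qed.

Lemma pos_def_twist phi l : pos_def phi -> pos_def (twist phi l).
Proof.
by move=> pd; elim: l => //= -[v b] l IH; exact: pos_def_twist1.
Qed.

Lemma pos_def_ge0 phi : pos_def phi -> 0 <= phi 0.
Proof. by move=> /(_ [:: (0, 1)]); rewrite !big_seq1/= subrr !mul1r. Qed.

Lemma twist1C phi v b w c u :
  twist1 v b (twist1 w c phi) u = twist1 w c (twist1 v b phi) u.
Proof.
rewrite /twist1 (addrAC u w v) (addrAC u w (- v)) (addrAC u (- w) v).
by rewrite (addrAC u (- w) (- v)); field.
Qed.

Lemma eq_twist1 phi phi' v b : phi =1 phi' -> twist1 v b phi =1 twist1 v b phi'.
Proof. by move=> e u; rewrite /twist1 !e. Qed.

Lemma twist_perm phi l l' : perm_eq l l' -> twist phi l =1 twist phi l'.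
Proof.
have mid l1 v b l2 : twist phi (l1 ++ (v, b) :: l2) =1 twist1 v b (twist phi (l1 ++ l2)).
  elim: l1 => //= -[w c] l1 IH u.
  by rewrite (eq_twist1 _ _ IH) twist1C.
elim: l l' => [|[v b] l IH] l' ll'.
  by move: ll'; rewrite perm_sym => /perm_nilP ->.
have vb : (v, b) \in l' by rewrite -(perm_mem ll') inE eqxx.
case/splitPr: vb ll' => l1 l2 ll'.
move=> u /=; rewrite mid; apply: eq_twist1; apply: IH.
by move: ll'; rewrite perm_sym -cat1s perm_catCA perm_cons perm_sym.
Qed.

Lemma twist_cons_split phi v l u :
  twist phi ((v, true) :: l) u + twist phi ((v, false) :: l) u = twist phi l u.
Proof. by rewrite /= /twist1 /sg; field. Qed.

(** Two distinct coins being independent given [chi], this is the expectation of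
    Re (chi v) * Re (chi w), also when [v = w]; it expands as half of
    [phi (v - w) + phi (v + w)]. *)
Lemma twist_pair_correlation phi v w : (forall u, phi (- u) = phi u) ->
  phi (v + w) = 0 ->
  \sum_(b : bool) \sum_(c : bool) sg R b * sg R c * twist phi [:: (v, b); (w, c)] 0
  = phi (v - w) / 2.
Proof.
move=> phiN vw0; rewrite !big_bool /= /twist1 /sg !add0r.
rewrite -(opprD v w) (_ : - v + w = - (v - w)); last by rewrite opprB addrC.
by rewrite !phiN vw0; field.
Qed.

End Twist.

Lemma twist_morph (R : realFieldType) (V W : zmodType) (phi : V -> R) (psi : W -> R)
    (f : {additive W -> V}) (l : seq (W * bool)) :
  (forall w, psi w = phi (f w)) ->
  forall u, twist psi l u = twist phi [seq (f x.1, x.2) | x <- l] (f u).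
Proof.
move=> fE; elim: l => //= -[v b] l IH u.
by rewrite /twist1 !IH raddfD raddfB.
Qed.

(** * Bits with a prescribed law on the unit interval *)

Definition unit_lebesgue (R : realType) : set (measurableTypeR R) -> \bar R :=
  mrestr (@lebesgue_measure R) (measurable_itv `[0%R, 1%R[).

Section UnitLebesgue.
Context (R : realType).

HB.instance Definition _ := Measure.on (@unit_lebesgue R).

Lemma unit_lebesgue_setT : @unit_lebesgue R setT = 1%E.
Proof.
rewrite /unit_lebesgue /mrestr setTI lebesgue_measure_itv/= lte_fin ltr01.
by rewrite oppr0 adde0.
Qed.

HB.instance Definition _ :=
  Measure_isProbability.Build _ _ _ (@unit_lebesgue R) unit_lebesgue_setT.

Lemma unit_lebesgue_itvco (a b : R) : 0 <= a -> a <= b -> b <= 1 ->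
  unit_lebesgue `[a, b[ = (b - a)%:E.
Proof.
move=> a0 ab b1; rewrite /unit_lebesgue /mrestr.
have -> : `[a, b[ `&` `[0, 1[ = `[a, b[%classic.
  apply/setIidl => x /=; rewrite !in_itv/= => /andP[ax xb].
  by rewrite (le_trans a0)// (lt_le_trans xb).
rewrite lebesgue_measure_itv/= lte_fin.
have [//|ba] := ltP a b.
by rewrite (_ : b = a) ?subrr//; apply/eqP; rewrite eq_le ba.
Qed.

End UnitLebesgue.

Section Digits.
Context (R : realType) (q : seq bool -> R).
Hypotheses (q_ge0 : forall s, 0 <= q s) (q_nil : q [::] = 1).
Hypothesis q_split : forall s, q (true :: s) + q (false :: s) = q s.

(** The points whose digits spell [s] form the interval of length [q s] starting
    at [cell_left s]; the cell of [s] is cut into that of [false :: s], on the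
    left, and that of [true :: s]. Words have their most recent digit first. *)
Fixpoint cell_left (s : seq bool) : R :=
  if s is b :: s' then
    cell_left s' + (if b then q (false :: s') else 0)
  else 0.

Definition next_digit (s : seq bool) (x : R) : bool :=
  cell_left s + q (false :: s) <= x.

Fixpoint digit_word (n : nat) (x : R) : seq bool :=
  if n is n'.+1 then next_digit (digit_word n' x) x :: digit_word n' x else [::].

Definition digit (k : nat) (x : measurableTypeR R) : bool :=
  next_digit (digit_word k x) x.

Lemma cell_bounds s : 0 <= cell_left s /\ cell_left s + q s <= 1.
Proof.
elim: s => [|b s [s0 s1]] /=; first by rewrite q_nil add0r.
have := q_split s; have := q_ge0 (true :: s); have := q_ge0 (false :: s).
by case: b; split; lra.
Qed.

Lemma digit_word_cell s x : 0 <= x < 1 ->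
  (digit_word (size s) x == s) = (cell_left s <= x < cell_left s + q s).
Proof.
move=> x01; elim: s => [|b s IH] /=; first by rewrite q_nil add0r x01 eqxx.
have := q_split s; have := q_ge0 (true :: s); have := q_ge0 (false :: s).
move=> qf qt qs; rewrite eqseq_cons IH.
have [xs|/negbTE xs] := boolP (digit_word (size s) x == s).
  move: (xs); rewrite IH => h; rewrite h andbT (eqP xs) /next_digit.
  move/andP: h => [sx xs1].
  case: b; first by rewrite eqb_id (lt_le_trans xs1) ?andbT//; lra.
  by rewrite eqbF_neg -ltNge addr0 sx.
move: (xs); rewrite IH => h; rewrite h andbF; move/negP: h => h.
apply/esym/negP => /andP[bx xb]; apply: h.
by case: b bx xb => ? ?; apply/andP; split; lra.
Qed.

Lemma measurable_digit_word s :
  measurable ([set x | digit_word (size s) x = s] : set (measurableTypeR R)).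
Proof.
elim: s => [|b s IH] /=.
  by rewrite (_ : [set _ | _] = setT)//; apply/seteqP; split.
rewrite (_ : [set _ | _] = [set x | digit_word (size s) x = s] `&`
    [set x | next_digit s x = b]).
  apply: measurableI => //.
  have mt : measurable ([set x | next_digit s x] : set (measurableTypeR R)).
    rewrite (_ : [set _ | _] = `[cell_left s + q (false :: s), +oo[%classic).
      exact: measurable_itv.
    by apply/seteqP; split => x /=; rewrite in_itv/= andbT.
  case: b => //.
  rewrite (_ : [set _ | _] = ~` [set x | next_digit s x]).
    exact: measurableC.
  by apply/seteqP; split => x /=; [move=> ->|move/negP/negbTE].
by apply/seteqP; split => x /= => [[<- e]|[e <-]]; rewrite e.
Qed.

Lemma measurable_digit k : measurable_fun setT (digit k).
Proof.
apply: (measurable_fun_bool true); rewrite setTI.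
rewrite (_ : _ @^-1` _ = \bigcup_(s : k.-tuple bool)
    [set x | digit_word (size (true :: s)) x = true :: s]).
  apply: fin_bigcup_measurable => // s _; exact: (measurable_digit_word (true :: s)).
have sz x n : size (digit_word n x) = n by elim: n => //= n ->.
apply/seteqP; split => x /=.
  move=> dx; exists (Tuple (introT eqP (sz x k))) => //=.
  by rewrite sz; congr (_ :: _).
by move=> [s _]; rewrite size_tuple /digit => -[].
Qed.

Lemma unit_lebesgue_digit_word s :
  unit_lebesgue ([set x | digit_word (size s) x = s] : set (measurableTypeR R))
  = (q s)%:E.
Proof.
have [a0 b1] := cell_bounds s.
transitivity (unit_lebesgue `[cell_left s, cell_left s + q s[%classic).
  rewrite /unit_lebesgue /mrestr; congr (lebesgue_measure _).
  apply/seteqP; split => x /= [+ x01]; move: (x01); rewrite !in_itv/= => /digit_word_cell e.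
    by move=> /eqP; rewrite e.
  by rewrite -e => /eqP.
by rewrite unit_lebesgue_itvco ?lerDl// addrAC subrr add0r.
Qed.

End Digits.

(** The words of length [N], with lengths given by [twist], define nested cells
    and thus digits on the unit interval: this plays the role of Kolmogorov's
    extension theorem. The law of an arbitrary finite set [L] of digits follows
    from that of the initial segments by adding the missing positions one at a
    time, both sides being additive in the value of the added digit. *)
Lemma bit_process_exists (R : realType) (V : zmodType) (phi : V -> R)
    (v : nat -> V) : pos_def phi -> phi 0 = 1 ->
  exists X : nat -> measurableTypeR R -> bool,
    (forall k, measurable_fun setT (X k)) /\
    (forall (L : seq nat) (s : nat -> bool), uniq L ->
      unit_lebesgue [set x | forall k, k \in L -> X k x = s k]
      = (twist phi [seq (v k, s k) | k <- L] 0)%:E).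
Proof.
move=> pd phi0.
pose fix word (s : seq bool) : seq (V * bool) :=
  if s is b :: s' then (v (size s'), b) :: word s' else [::].
pose q s := twist phi (word s) 0.
have q_ge0 s : 0 <= q s by apply/pos_def_ge0/pos_def_twist.
have q_split s : q (true :: s) + q (false :: s) = q s.
  exact: twist_cons_split.
exists (digit q); split=> [k|L s uL]; first exact: measurable_digit.
have mX k b : measurable [set x | digit q k x = b].
  rewrite -[X in measurable X]setTI.
  exact: (measurable_digit q k measurableT (I : measurable [set b])).
have mC (M : seq nat) s' : measurable [set x | forall k, k \in M -> digit q k x = s' k].
  rewrite (_ : [set _ | _] =
     \bigcap_(k in [set` M]) [set x | digit q k x = s' k]).
    by apply: fin_bigcap_measurable => //; exact: finite_seq.
  by apply/seteqP; split.
have [N LN] : exists N, {subset L <= iota 0 N}.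
  exists (\max_(k <- L) k).+1 => k kL; rewrite mem_iota /= add0n ltnS.
  exact: leq_bigmax_seq.
have [m] : exists m, (N - size L < m)%N by exists (N - size L).+1.
elim: m => // m IH in L s uL LN *; rewrite ltnS => Lm.
have [NL|/allPn[k]] := boolP (all [in L] (iota 0 N)).
  pose w := fix w n := if n is n'.+1 then s n' :: w n' else [::].
  have szw n : size (w n) = n by elim: n => //= n ->.
  have wordw n : word (w n) = [seq (v k, s k) | k <- rev (iota 0 n)].
    elim: n => // n IHn; rewrite -addn1 iotaD rev_cat map_cat -IHn/= add0n addn1 /=.
    by rewrite szw.
  have LiN : L =i iota 0 N.
    by move=> k; apply/idP/idP => [/LN//|]; exact: (allP NL).
  have pL : perm_eq L (rev (iota 0 N)).
    rewrite uniq_perm// ?rev_uniq ?iota_uniq// => k.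
    by rewrite mem_rev LiN.
  rewrite (twist_perm phi (perm_map _ pL)) -wordw.
  rewrite -/(q (w N)) -(unit_lebesgue_digit_word q_ge0 _ q_split)//.
  congr unit_lebesgue; apply/seteqP; split => x /=.
    rewrite szw => xL; have {}xL k : (k < N)%N -> digit q k x = s k.
      by move=> kN; apply: xL; rewrite LiN mem_iota.
    elim: N xL {IH LN Lm NL LiN pL} => //= n IHn xL.
    have e := IHn (fun k kn => xL k (ltnW kn)).
    by congr cons => //; exact: xL.
  rewrite szw => xw k; rewrite LiN mem_iota/= add0n.
  elim: N xw {IH LN Lm NL LiN pL} => //= n IHn [xn xw].
  by rewrite ltnS leq_eqVlt => /predU1P[->//|]; exact: IHn.
move=> kN kL.
(* the induction adds the missing position [k], with both possible values *)
pose s' b := fun j => if j == k then b else s j.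
have split_eq b : [seq (v j, s' b j) | j <- k :: L] =
    (v k, b) :: [seq (v j, s j) | j <- L].
  rewrite /= /s' eqxx; congr cons; apply/eq_in_map => j jL.
  by rewrite ifN//; apply: contraNneq kL => <-.
have sub b : [set x | forall j, j \in k :: L -> digit q j x = s' b j] =
    [set x | forall j, j \in L -> digit q j x = s j] `&` [set x | digit q k x = b].
  apply/seteqP; split => x /=.
    move=> h; split; last by rewrite h ?mem_head// /s' eqxx.
    move=> j jL; rewrite h ?inE ?jL ?orbT// /s' ifN//.
    by apply: contraNneq kL => <-.
  move=> [h1 h2] j; rewrite inE /s'; case: eqP => [-> //|_ /=]; exact: h1.
have rec b : unit_lebesgue ([set x | forall j, j \in L -> digit q j x = s j]
     `&` [set x | digit q k x = b]) =
    (twist phi ((v k, b) :: [seq (v j, s j) | j <- L]) 0)%:E.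
  rewrite -sub -split_eq; apply: IH.
  - by rewrite cons_uniq kL.
  - by move=> j; rewrite inE => /predU1P[->//|/LN].
  - have := @uniq_leq_size _ (k :: L) (iota 0 N); rewrite /= kL uL size_iota.
    move=> /(_ isT) NL'; have /NL' : {subset k :: L <= iota 0 N}.
      by move=> j; rewrite inE => /predU1P[->//|/LN].
    by lia.
rewrite -(twist_cons_split phi (v k)) EFinD -!rec -measureU.
- rewrite -setIUr (_ : _ `|` _ = setT) ?setIT//.
  by apply/seteqP; split => // x _ /=; case: digit; [left|right].
- exact: measurableI.
- exact: measurableI.
- by apply/seteqP; split => // x [[_ /= ->] [_ ]].
Qed.

(** * Families of bits, their symmetries and correlations *)

Section BitFamilies.
Context (R : realType) (I : choiceType) (V : zmodType).
Local Notation P := (@unit_lebesgue R).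

Lemma measurable_bits (Y : I -> measurableTypeR R -> bool) (l : seq (I * bool)) :
  (forall i, measurable_fun setT (Y i)) ->
  measurable [set x | forall c, c \in l -> Y c.1 x = c.2].
Proof.
move=> mY.
rewrite (_ : [set _ | _] = \bigcap_(c in [set` l]) [set x | Y c.1 x = c.2]).
  apply: fin_bigcap_measurable => [|c _]; first exact: finite_seq.
  by rewrite -[X in measurable X]setTI; exact: (mY c.1 measurableT [set c.2] Logic.I).
by apply/seteqP; split.
Qed.

Definition has_bit_law (phi : V -> R) (v : I -> V)
    (Y : I -> measurableTypeR R -> bool) :=
  (forall i, measurable_fun setT (Y i)) /\
  (forall (L : seq I) (s : I -> bool), uniq L ->
    P [set x | forall i, i \in L -> Y i x = s i]
    = (twist phi [seq (v i, s i) | i <- L] 0)%:E).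

Lemma bit_family_exists (phi : V -> R) (v : I -> V) (i0 : I) :
  countable [set: I] -> pos_def phi -> phi 0 = 1 -> exists Y, has_bit_law phi v Y.
Proof.
move=> /countable_injP[code code_inj] pd phi0.
pose decode k := xget i0 [set i | code i = k].
have codeK : cancel code decode.
  move=> i; apply: code_inj; rewrite ?inE//.
  exact: (@xgetI _ i0 [set j | code j = code i] i erefl).
have [X [mX XL]] := bit_process_exists (v \o decode) pd phi0.
exists (X \o code); split=> [i|L s uL]; first exact: mX.
have := XL [seq code i | i <- L] (s \o decode).
rewrite map_inj_uniq; last exact: can_inj codeK.
have -> : [seq ((v \o decode) k, (s \o decode) k) | k <- [seq code i | i <- L]] =
    [seq (v i, s i) | i <- L].
  by rewrite -map_comp; apply: eq_map => i /=; rewrite codeK.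
move=> /(_ uL) <-; congr unit_lebesgue; apply/seteqP; split => x /= h.
  by move=> _ /mapP[i iL ->]; rewrite codeK; exact: h.
by move=> i iL; rewrite h ?map_f//= codeK.
Qed.

Variables (phi : V -> R) (v : I -> V) (Y : I -> measurableTypeR R -> bool).
Hypothesis YL : has_bit_law phi v Y.

(** The law of the bits only depends on [phi] and on the vectors [v i], hence
    is invariant under the symmetries of these data. *)
Lemma bit_law_invariant (lambda : {additive V -> V}) (sigma sigma' : I -> I)
    (l : seq (I * bool)) :
  cancel sigma sigma' -> (forall u, phi u = phi (lambda u)) ->
  (forall i, lambda (v i) = v (sigma i)) ->
  P [set x | forall c, c \in l -> Y (sigma c.1) x = c.2] =
  P [set x | forall c, c \in l -> Y c.1 x = c.2].
Proof.
move=> sigmaK lambda_phi lambda_v.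
(* contradictory constraints define the empty set on both sides *)
have [[s sl]|nos] := pselect (exists s : I -> bool, forall c, c \in l -> c.2 = s c.1).
  pose L := undup [seq c.1 | c <- l].
  have E (tau : I -> I) : [set x | forall c, c \in l -> Y (tau c.1) x = c.2] =
      [set x | forall i, i \in L -> Y (tau i) x = s i].
    apply/seteqP; split => x /= h.
      by move=> i; rewrite mem_undup => /mapP[c cl ->]; rewrite -(sl c cl); exact: h.
    by move=> c cl; rewrite h ?(sl c cl)// mem_undup map_f.
  rewrite E (E id) (YL.2 L)// ?undup_uniq//.
  have -> : [set x | forall i, i \in L -> Y (sigma i) x = s i] =
      [set x | forall i, i \in map sigma L -> Y i x = s (sigma' i)].
    apply/seteqP; split => x /= h.
      by move=> _ /mapP[i iL ->]; rewrite sigmaK; exact: h.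
    by move=> i iL; rewrite h ?map_f// sigmaK.
  rewrite YL.2; last by rewrite map_inj_uniq ?undup_uniq//; exact: can_inj sigmaK.
  rewrite -[in LHS](raddf0 lambda) -map_comp; congr EFin.
  rewrite [RHS](twist_morph (phi := phi) (f := lambda))// -map_comp.
  by congr twist; apply: eq_map => i /=; rewrite sigmaK lambda_v.
have E (tau : I -> I) : [set x | forall c, c \in l -> Y (tau c.1) x = c.2] = set0.
  rewrite -subset0 => x /= h; apply: nos; exists (fun i => Y (tau i) x).
  by move=> c /h.
by rewrite E (E id).
Qed.

Definition bit_sign i x : R := sg R (Y i x).

Lemma measurable_bit_sign i : measurable_fun setT (bit_sign i).
Proof.
rewrite /bit_sign /sg; apply: measurable_fun_ifT => //.
exact: YL.1.
Qed.

Lemma bit_sign_norm i x : `|bit_sign i x| = 1.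
Proof. by rewrite /bit_sign /sg; case: (Y i x); rewrite ?normrN normr1. Qed.

Lemma bit_sign_mul_integrable i j :
  P.-integrable setT (EFin \o (fun x => bit_sign i x * bit_sign j x)).
Proof.
apply: measurable_bounded_integrable => //.
- by rewrite [X in (X < _)%E]unit_lebesgue_setT ltry.
- by apply: measurable_funM; exact: measurable_bit_sign.
- exists 1; split=> // M M1 x _.
  by rewrite /= normrM !bit_sign_norm mulr1 ltW.
Qed.

Lemma bit_sign_correlation i j : (forall u, phi (- u) = phi u) ->
  (forall i j, phi (v i + v j) = 0) ->
  \int[P]_x (bit_sign i x * bit_sign j x) =
  if i == j then 1 else phi (v i - v j) / 2.
Proof.
move=> phiN phi2; have [<-|ij] := eqVneq i j.
  transitivity (\int[P]_(_ in setT) (1 : R)).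
    by apply: eq_Rintegral => x _; rewrite -expr2 -real_normK ?num_real// bit_sign_norm expr1n.
  by rewrite Rintegral_cst// [X in fine X]unit_lebesgue_setT mulr1.
rewrite -(@twist_pair_correlation _ _ phi (v i) (v j))//.
pose A b c := [set x | forall k, k \in [:: (i, b); (j, c)] -> Y k.1 x = k.2].
have AE b c x : \1_(A b c) x = ((Y i x == b) && (Y j x == c))%:R :> R.
  rewrite indicE (_ : (x \in A b c) = (Y i x == b) && (Y j x == c))//.
  apply/idP/idP.
    by rewrite inE => h; rewrite (h (i, b)) ?(h (j, c)) ?inE ?eqxx ?orbT.
  move=> /andP[/eqP Yi /eqP Yj]; rewrite inE => k; rewrite !inE.
  by move=> /orP[] /eqP ->.
have PA b c : P (A b c) = (twist phi [:: (v i, b); (v j, c)] 0)%:E.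
  pose s k := if k == i then b else c.
  have := YL.2 [:: i; j] s; rewrite /= inE andbT ij => /(_ isT).
  rewrite /s eqxx (negPf (_ : j != i)) 1?eq_sym// => <-.
  congr unit_lebesgue; apply/seteqP; split => x /= h.
    move=> k; rewrite !inE => /orP[] /eqP ->.
      by rewrite eqxx (h (i, b))// inE eqxx.
    by rewrite eq_sym (negPf ij) (h (j, c))// !inE eqxx orbT.
  move=> k; rewrite !inE => /orP[] /eqP -> /=.
    by rewrite h ?inE ?eqxx.
  by rewrite h ?inE ?eqxx ?orbT// eq_sym (negPf ij).
have iA b c : P.-integrable setT (fun x => (sg R b * sg R c * \1_(A b c) x)%:E).
  under eq_fun do rewrite EFinM.
  apply: integrableZl => //; apply: integrable_indic => //.
  exact: measurable_bits YL.1.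
rewrite /Rintegral -[RHS]/(fine _%:E); congr fine.
transitivity (\int[P]_x (\sum_(b : bool) \sum_(c : bool)
    (sg R b * sg R c * \1_(A b c) x)%:E))%E.
  apply: eq_integral => x _; rewrite !big_bool /= !AE -!EFinD.
  rewrite /bit_sign; congr EFin.
  by case: (Y i x); case: (Y j x); rewrite /sg /=; ring.
rewrite integral_sum//; last by move=> b; apply: integrable_sum.
rewrite -sumEFin; apply: eq_bigr => b _.
rewrite integral_sum// -sumEFin; apply: eq_bigr => c _.
under eq_integral do rewrite EFinM.
rewrite integralZl//; last by apply: integrable_indic => //; exact: measurable_bits YL.1.
rewrite integral_indic//; last exact: measurable_bits YL.1.
by rewrite setIT [X in (_ * X)%E]PA -EFinM.
Qed.

End BitFamilies.

(** * The variance of averages of bits *)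

Section Variance.
Context d (S : measurableType d) (R : realType) (mu : {measure set S -> \bar R}).

Lemma integrable_Rsum (J : Type) (r : seq J) (f : J -> S -> R) :
  (forall j, mu.-integrable setT (EFin \o f j)) ->
  mu.-integrable setT (EFin \o (fun x => \sum_(j <- r) f j x)).
Proof.
move=> fi; rewrite (_ : _ \o _ = fun x => (\sum_(j <- r) (f j x)%:E)%E).
  by apply: integrable_sum => // j _; exact: fi.
by apply/funext => x; rewrite /= sumEFin.
Qed.

Lemma Rintegral_sum (J : Type) (r : seq J) (f : J -> S -> R) :
  (forall j, mu.-integrable setT (EFin \o f j)) ->
  \int[mu]_x (\sum_(j <- r) f j x) = \sum_(j <- r) \int[mu]_x f j x.
Proof.
move=> fi; elim: r => [|j r IH].
  rewrite big_nil; under eq_Rintegral do rewrite big_nil.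
  by rewrite Rintegral_cst// mul0r.
rewrite big_cons -IH -RintegralD//; last exact: integrable_Rsum.
by apply: eq_Rintegral => x _; rewrite big_cons.
Qed.

Lemma Rintegral_sqr_sum (J : finType) (c : J -> R) (f : J -> S -> R) :
  (forall j k, mu.-integrable setT (EFin \o (fun x => f j x * f k x))) ->
  \int[mu]_x (\sum_j c j * f j x) ^+ 2 =
  \sum_j \sum_k c j * c k * \int[mu]_x (f j x * f k x).
Proof.
move=> fi.
have ci j k : mu.-integrable setT (EFin \o (fun x => c j * c k * (f j x * f k x))).
  rewrite (_ : _ \o _ = fun x => ((c j * c k)%:E * (f j x * f k x)%:E)%E).
    by apply: integrableZl => //; exact: fi.
  by apply/funext => x; rewrite /= EFinM.
transitivity (\int[mu]_x (\sum_j \sum_k c j * c k * (f j x * f k x))).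
  apply: eq_Rintegral => x _; rewrite expr2 mulr_suml; apply: eq_bigr => j _.
  by rewrite mulr_sumr; apply: eq_bigr => k _; ring.
rewrite Rintegral_sum => [|j]; last exact: integrable_Rsum.
apply: eq_bigr => j _; rewrite Rintegral_sum//; apply: eq_bigr => k _.
by rewrite RintegralZl//; exact: fi.
Qed.

End Variance.

Section BitAverages.
Context (R : realType) (I : choiceType) (V : zmodType).
Variables (phi : V -> R) (v : I -> V) (Y : I -> measurableTypeR R -> bool).
Hypothesis YL : has_bit_law phi v Y.
Hypothesis phiN : forall u, phi (- u) = phi u.
Hypothesis phi2 : forall i j, phi (v i + v j) = 0.
Local Notation P := (@unit_lebesgue R).

(** The average of [m] bits of vector [v] approximates Re (chi v) for the random
    character [chi]. The difference of two such averages has variance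
    [1 - phi (v - w)], up to the sampling noise [m^-1]. *)
Lemma bit_average_variance (m : nat) (a : bool -> 'I_m -> I) (w : bool -> V) :
  (0 < m)%N -> (forall b c j k, (a b j == a c k) = (b == c) && (j == k)) ->
  (forall b j, v (a b j) = w b) -> phi 0 = 1 ->
  \int[P]_x ((\sum_j (bit_sign Y (a true j) x - bit_sign Y (a false j) x)) / m%:R) ^+ 2
  = 1 - phi (w true - w false) + m%:R^-1.
Proof.
move=> m0 a_inj vw phi0.
have m_neq0 : (m%:R : R) != 0 by rewrite pnatr_eq0 -lt0n.
pose f (u : bool * 'I_m) := bit_sign Y (a u.1 u.2).
transitivity (\int[P]_x (\sum_u (sg R u.1 / m%:R) * f u x) ^+ 2).
  apply: eq_Rintegral => x _; congr (_ ^+ 2).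
  rewrite -(pair_bigA _ (fun b j => sg R b / m%:R * f (b, j) x))/= big_bool/=.
  rewrite -big_split/= mulr_suml; apply: eq_bigr => j _.
  by rewrite /sg /f /=; field.
rewrite Rintegral_sqr_sum; last by move=> j k; exact: (bit_sign_mul_integrable YL).
have corr (u u' : bool * 'I_m) : \int[P]_x (f u x * f u' x) =
   ((u == u')%:R + (if u.1 == u'.1 then 1 else phi (w true - w false))) / 2.
  rewrite /f (bit_sign_correlation YL)// a_inj !vw.
  case: u u' => [b j] [c k] /=; rewrite xpair_eqE.
  have [bc|bc] /= := eqVneq b c.
    rewrite bc subrr phi0; case: eqP => _ /=; last by rewrite add0r.
    by rewrite -[1 + 1]/2 divff.
  rewrite add0r; case: b c bc => -[] //= _.
  by rewrite -opprB phiN.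
under eq_bigr do under eq_bigr do rewrite corr.
rewrite -(pair_bigA _ (fun b j => \sum_u' (sg R b / m%:R) * (sg R u'.1 / m%:R) *
  ((((b, j) == u')%:R + (if b == u'.1 then 1 else phi (w true - w false))) / 2)))/=.
set e := phi _.
transitivity (\sum_(b : bool) \sum_(j < m) (m%:R ^-2 * (m%:R * (1 - e) + 1) / 2)).
  apply: eq_bigr => b _; apply: eq_bigr => j _.
  rewrite -(pair_bigA _ (fun c k => (sg R b / m%:R) * (sg R c / m%:R) *
    ((((b, j) == (c, k))%:R + (if b == c then 1 else e)) / 2)))/= big_bool/=.
  rewrite -big_split/=.
  transitivity (\sum_(k < m) m%:R ^- 2 / 2 * ((j == k)%:R + (1 - e))).
    by apply: eq_bigr => k _; case: b; rewrite !xpair_eqE/= /sg; field.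
  rewrite -mulr_sumr big_split/= sumr_const card_ord.
  rewrite (bigD1 j)//= eqxx big1 ?addr0; last first.
    by move=> k /negPf kj; rewrite eq_sym kj.
  by rewrite -(mulr_natl (1 - e) m) /=; field.
rewrite big_bool/= !sumr_const card_ord -(mulr_natl (_ / 2) m).
by field.
Qed.

End BitAverages.

(** * The space of bits and its measure *)

Section BitSpace.
Context (I : choiceType).

Definition cylinder (n : nat) (l : seq (I * bool)) : set (nat * (I -> bool)) :=
  [set x | x.1 = n /\ forall c, c \in l -> x.2 c.1 = c.2].

(** The empty set is included to make this class stable under intersections. *)
Definition cylinders : set (set (nat * (I -> bool))) :=
  [set A | A = set0 \/ exists n l, A = cylinder n l].

Definition bit_space := g_sigma_algebraType cylinders.

Lemma cylinders_setI : setI_closed cylinders.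
Proof.
move=> A B [->|[n [l ->]]]; first by rewrite set0I; left.
move=> [->|[m [k ->]]]; first by rewrite setI0; left.
have [<-|nm] := eqVneq n m; last first.
  left; rewrite -subset0 => x [[/= xn _] [/= xm _]].
  by move: nm; rewrite -xn -xm eqxx.
right; exists n, (l ++ k); apply/seteqP; split => x /=.
  move=> [[xn xl] [_ xk]]; split=> // c.
  by rewrite mem_cat => /orP[/xl|/xk].
move=> [xn xlk]; split; split=> // c cl; apply: xlk.
  by rewrite mem_cat cl.
by rewrite mem_cat cl orbT.
Qed.

Lemma measurable_cylinder n l : measurable (cylinder n l : set bit_space).
Proof. by apply: sub_sigma_algebra; right; exists n, l. Qed.

Lemma measurable_to_bit_space d (S : measurableType d) (f : S -> bit_space) :
  (forall n l, measurable (f @^-1` cylinder n l)) -> measurable_fun setT f.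
Proof.
move=> mf; apply: (@measurability _ _ S bit_space setT f cylinders) => //.
move=> _ [_ [->|[n [l ->]]] <-]; first by rewrite preimage_set0 setI0.
by rewrite setTI; exact: mf.
Qed.

Definition relabel (sigma : I -> I) (x : bit_space) : bit_space :=
  (x.1, x.2 \o sigma).

Lemma relabel_cylinder sigma n l :
  relabel sigma @^-1` cylinder n l =
  cylinder n [seq (sigma c.1, c.2) | c <- l].
Proof.
apply/seteqP; split => x /= [xn xl]; split=> //.
  by move=> _ /mapP[c cl ->] /=; exact: xl.
by move=> c cl; exact: (xl (sigma c.1, c.2) (map_f _ cl)).
Qed.

Lemma measurable_relabel sigma : measurable_fun setT (relabel sigma).
Proof.
apply: measurable_to_bit_space => n l.
rewrite relabel_cylinder; exact: measurable_cylinder.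
Qed.

Context (R : realType) (Y : nat -> I -> measurableTypeR R -> bool).
Hypothesis mY : forall n i, measurable_fun setT (Y n i).
Local Notation P := (@unit_lebesgue R).

Definition bit_map n (x : measurableTypeR R) : bit_space := (n, Y n ^~ x).

Lemma measurable_bit_map n : measurable_fun setT (bit_map n).
Proof.
apply: measurable_to_bit_space => m l.
have [<-|nm] := eqVneq n m; last first.
  rewrite (_ : _ @^-1` _ = set0)// -subset0 => x [/= nm' _].
  by move: nm; rewrite nm' eqxx.
rewrite (_ : _ @^-1` _ = [set x | forall c, c \in l -> Y n c.1 x = c.2]).
  exact: measurable_bits (mY n).
by apply/seteqP; split => x /=; [case|].
Qed.

HB.instance Definition _ n :=
  isMeasurableFun.Build _ _ _ _ (bit_map n) (measurable_bit_map n).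

Definition bit_law n : {measure set bit_space -> \bar R} :=
  distribution P (bit_map n).

(** An infinite measure: the sum over [n] of the probability laws of the
    families [Y n], carried by disjoint copies of the space of bits. *)
Definition bit_measure : {measure set bit_space -> \bar R} := mseries bit_law 0.

Lemma bit_measure_cylinder n l :
  bit_measure (cylinder n l) = P [set x | forall c, c \in l -> Y n c.1 x = c.2].
Proof.
rewrite /bit_measure/= /mseries.
rewrite (@nneseriesD1 _ _ n)// eseries0 ?adde0.
  congr unit_lebesgue; apply/seteqP; split => x /=; first by case.
  by move=> h; split.
move=> k _ /= kn; rewrite /distribution /pushforward.
rewrite (_ : _ @^-1` _ = set0) ?measure0// -subset0 => x [/= kn' _].
by move: kn; rewrite kn' eqxx.
Qed.

Lemma bit_measure_relabel (sigma : I -> I) :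
  (forall n (l : seq (I * bool)),
    P [set x | forall c, c \in l -> Y n (sigma c.1) x = c.2] =
    P [set x | forall c, c \in l -> Y n c.1 x = c.2]) ->
  forall A, measurable A -> bit_measure (relabel sigma @^-1` A) = bit_measure A.
Proof.
move=> inv A mA.
have msigma := measurable_relabel sigma.
pose m1 := measure_function_pushforward__canonical__measure_function_Measure bit_measure msigma.
change (m1 A = bit_measure A).
apply: (@measure_unique _ R bit_space cylinders (cylinder ^~ [::]) erefl
  cylinders_setI _ _ m1 bit_measure) => //.
- by move=> n; right; exists n, [::].
- by apply/seteqP; split => // x _; exists x.1.
- move=> _ [->|[n [l ->]]]; first by rewrite !measure0.
  rewrite [LHS](_ : _ = bit_measure (relabel sigma @^-1` cylinder n l))//.
  rewrite relabel_cylinder !bit_measure_cylinder -[RHS]inv.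
  congr unit_lebesgue; apply/seteqP; split => x /= h.
    by move=> c cl; exact: (h _ (map_f (fun c => (sigma c.1, c.2)) cl)).
  by move=> _ /mapP[c cl ->] /=; exact: h.
- move=> n; rewrite [ltLHS](_ : _ = bit_measure (relabel sigma @^-1` cylinder n [::]))//.
  rewrite relabel_cylinder bit_measure_cylinder.
  apply: (@le_lt_trans _ _ 1%E); last exact: ltry.
  exact: (probability_le1 P (measurable_bits _ (mY n))).
Qed.

Lemma ge0_integral_bit_measure (f : bit_space -> \bar R) :
  measurable_fun setT f -> (forall x, 0 <= f x)%E ->
  (\int[bit_measure]_x f x = \sum_(0 <= n <oo) \int[P]_x f (bit_map n x))%E.
Proof.
move=> mf f0; rewrite ge0_integral_measure_series//.
apply: eq_eseriesr => n _.
by rewrite /bit_law ge0_integral_distribution.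
Qed.

End BitSpace.

(** * Moments of bounded variables *)

Section MomentBounds.
Context d (S : measurableType d) (R : realType) (P : probability S R).
Variables (p : R) (D : S -> R).
Hypothesis p1 : 1 <= p.
Hypothesis mD : measurable_fun [set: S] D.
Hypothesis D2 : forall x, `|D x| <= 2.

Let integrable_sqr : P.-integrable setT (EFin \o (fun x => D x ^+ 2)).
Proof.
apply: measurable_bounded_integrable => //.
- exact: le_lt_trans (probability_le1 P measurableT) (ltry _).
- exact: measurable_funX.
- exists 4; split=> // M M4 x _; rewrite /= normrX ltW// (le_lt_trans _ M4)//.
  by have := D2 x; have := normr_ge0 (D x); nra.
Qed.

Let integral_affine_sqr (a b : R) :
  (\int[P]_x (a + b * D x ^+ 2)%:E = (a + b * \int[P]_x (D x ^+ 2))%:E)%E.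
Proof.
have ia : P.-integrable setT (EFin \o (fun=> a)) by exact: finite_measure_integrable_cst.
have ib : P.-integrable setT (EFin \o (fun x => b * D x ^+ 2)).
  rewrite (_ : _ \o _ = fun x => (b%:E * (D x ^+ 2)%:E)%E); first exact: integrableZl.
  by apply/funext => x; rewrite /= EFinM.
rewrite -(RintegralZl _ measurableT integrable_sqr) -[a in RHS]mulr1.
have -> : (1 : R) = fine (P setT) by rewrite (probability_setT P).
rewrite -(Rintegral_cst P measurableT) -RintegralD// /Rintegral fineK//.
apply: integrable_fin_num => //.
rewrite (_ : (fun x => _) = (EFin \o (fun=> a)) \+ (EFin \o (fun x => b * D x ^+ 2)%R))%E.
  exact: integrableD.
by apply/funext => x; rewrite /= EFinD.
Qed.

Let measurable_moment : measurable_fun [set: S] (fun x => (`|D x| `^ p)%:E).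
Proof.
apply/measurable_EFinP; apply: (measurableT_comp (measurable_powR _)) => //.
exact: measurableT_comp.
Qed.

Let measurable_affine_sqr (a b : R) :
  measurable_fun [set: S] (fun x => (a + b * D x ^+ 2)%:E).
Proof.
apply/measurable_EFinP; apply: measurable_funD => //.
by apply: measurable_funM => //; exact: measurable_funX.
Qed.

(** [D] being bounded, its moment of order [p >= 1] is controlled by the first
    one, which is at most [(e + D ^+ 2 / e) / 2] by the AM-GM inequality. *)
Lemma moment_le (e : R) : 0 < e ->
  (\int[P]_x (`|D x| `^ p)%:E <= (2 `^ p * (e + (\int[P]_x (D x ^+ 2)) / e))%:E)%E.
Proof.
move=> e0.
rewrite [X in X%:E](_ : _ = 2 `^ p * e + 2 `^ p / e * \int[P]_x (D x ^+ 2)); last by ring.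
rewrite -integral_affine_sqr.
apply: ge0_le_integral => //.
move=> x _; rewrite lee_fin.
have Du : `|D x| `^ p <= 2 `^ p * `|D x|.
  have [->|D0] := eqVneq (D x) 0; first by
    rewrite normr0 mulr0 powR0// gt_eqF// (lt_le_trans ltr01).
  rewrite [X in X `^ _ <= _](_ : _ = 2 * (`|D x| / 2)); last by field.
  rewrite powRM ?divr_ge0// ler_wpM2l ?powR_ge0//.
  apply: (@le_trans _ _ (`|D x| / 2)).
    by apply: ge1r_powR => //; rewrite divr_gt0 ?normr_gt0//= ler_pdivrMr// mul1r.
  by rewrite ler_pdivrMr// ler_peMr// ler1n.
apply: le_trans Du _; rewrite -mulrA -mulrDr ler_wpM2l ?powR_ge0//.
rewrite -(real_normK (num_real (D x))).
have : 0 <= (`|D x| - e) ^+ 2 / e by rewrite divr_ge0 ?sqr_ge0// ltW.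
have -> : (`|D x| - e) ^+ 2 / e = e^-1 * `|D x| ^+ 2 - 2 * `|D x| + e.
  by field; rewrite gt_eqF.
by have := normr_ge0 (D x); lra.
Qed.

(** Where [|D| <= 1/2] the square is at most [1/4]; elsewhere [(2 |D|)^p >= 1]
    dominates a quarter of the square. *)
Lemma moment_ge :
  (((\int[P]_x (D x ^+ 2) - 4^-1) / (4 * 2 `^ p))%:E <= \int[P]_x (`|D x| `^ p)%:E)%E.
Proof.
have c0 : 0 < 4 * 2 `^ p :> R by rewrite mulr_gt0 ?powR_gt0.
have h : (\int[P]_x (0 + 1 * D x ^+ 2)%:E <=
    \int[P]_x ((4^-1)%:E + (4 * 2 `^ p)%:E * (`|D x| `^ p)%:E))%E.
  apply: ge0_le_integral => //.
  - by move=> x _; rewrite lee_fin add0r mul1r sqr_ge0.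
  - by apply: emeasurable_funD => //; exact: measurable_funeM.
  move=> x _; rewrite -EFinM -EFinD lee_fin add0r mul1r -(real_normK (num_real (D x))).
  have [Dh|Dh] := leP (`|D x|) 2^-1.
    apply: (@le_trans _ _ 4^-1); last by rewrite lerDl mulr_ge0 ?powR_ge0// ltW.
    by have := normr_ge0 (D x); nra.
  apply: (@le_trans _ _ 4); first by have := D2 x; have := normr_ge0 (D x); nra.
  rewrite -mulrA -powRM// (@le_trans _ _ (4 * 1))// ?mulr1//.
  apply: (@le_trans _ _ (4 * (2 * `|D x|) `^ p)); last by rewrite lerDr invr_ge0.
  rewrite ler_peMr//; apply: le_trans (le1r_powR _ p1); last by lra.
  by lra.
rewrite integral_affine_sqr add0r mul1r in h.
rewrite ge0_integralD// in h; last exact: measurable_funeM.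
rewrite ge0_integralZl_EFin// in h.
rewrite integral_cst// in h.
move: h; rewrite [X in (_ <= _ * X + _)%E -> _](probability_setT P) mule1 => h.
rewrite EFinM -lee_pdivlMr ?invr_gt0// invrK muleC.
by rewrite EFinB leeBlDl.
Qed.

End MomentBounds.

(** * Affine actions on L^p from measure-preserving actions *)

Section Koopman.
Context d (T : measurableType d) (R : realType).
Variables (mu : {measure set T -> \bar R}) (rho : T -> T).
Hypothesis mrho : measurable_fun [set: T] rho.
Hypothesis rho_mu : forall A, measurable A -> mu (rho @^-1` A) = mu A.

Lemma ge0_integral_comp (f : T -> \bar R) : measurable_fun [set: T] f ->
  (forall x, 0 <= f x)%E -> (\int[mu]_x f (rho x) = \int[mu]_x f x)%E.
Proof.
move=> mf f0; rewrite -[LHS](ge0_integral_pushforward mrho mu (D := setT))//.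
by apply: eq_measure_integral => A mA _; exact: rho_mu.
Qed.

Lemma ae_eq_comp (f g : T -> R) :
  f = g %[ae mu] -> f \o rho = g \o rho %[ae mu].
Proof.
move=> [N [mN N0 fgN]]; exists (rho @^-1` N); split.
- by rewrite -[X in measurable X]setTI; exact: mrho.
- by rewrite -N0; exact: rho_mu.
- by move=> x /= h; apply: fgN => /= h'; apply: h => _; exact: h'.
Qed.

Variables (r : R) (p1 : (1 <= r%:E)%E).
Local Notation Lf := (LfunType mu p1).
Local Notation Lp := (LspaceType mu p1).

Lemma Lnorm_comp (f : T -> R) : measurable_fun [set: T] f ->
  Lnorm mu r%:E (EFin \o (f \o rho)) = Lnorm mu r%:E (EFin \o f).
Proof.
move=> mf; rewrite unlock /Lnorm; congr poweR.
rewrite -[RHS]ge0_integral_comp => [//| |x]; last by rewrite lee_fin powR_ge0.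
apply/measurable_EFinP; apply: (measurableT_comp (measurable_powR _)) => //.
exact: measurableT_comp.
Qed.

Lemma Lfun_comp (f : Lf) : ((f : T -> R) \o rho) \in Lfun mu r%:E.
Proof.
apply/andP; split; rewrite inE/=.
  exact: measurableT_comp (measurable_funPT f) mrho.
by rewrite /finite_norm (Lnorm_comp (measurable_funPT f)); exact: Lfunction_finite.
Qed.

Definition koopman (f : Lf) : Lf := Lfun_Sub p1 (Lfun_comp f).

Definition koopman_class (f : Lp) : Lp := Lclass (koopman (Lrepr f)).

Lemma koopman_classE (f : Lf) : koopman_class (Lclass f) = Lclass (koopman f).
Proof. by apply/Lclass_eqP; apply: ae_eq_comp; exact: LclassK_ae. Qed.

Lemma koopman_class_is_linear : linear koopman_class.
Proof.
move=> a f g; rewrite -(LreprK f) -(LreprK g) -LclassZ -LclassD !koopman_classE.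
by rewrite -LclassZ -LclassD; congr Lclass; apply/LfuneqP.
Qed.

HB.instance Definition _ :=
  GRing.isLinear.Build R Lp Lp *:%R koopman_class koopman_class_is_linear.

Lemma Lclass_norm (f : Lf) : `|Lclass f| = fine (Lnorm mu r%:E (EFin \o f)).
Proof.
rewrite Lspace_normrE; congr fine; apply: ae_eq_Lnorm => //.
- by apply/measurable_EFinP; exact: (measurable_funPT (Lrepr (Lclass f))).
- by apply/measurable_EFinP; exact: (measurable_funPT f).
- by apply: filterS (Lclass_ae f) => x /(_ I) /= ->.
Qed.

Lemma koopman_class_norm f : `|koopman_class f| = `|f|.
Proof.
rewrite -(LreprK f) koopman_classE !Lclass_norm.
by rewrite (Lnorm_comp (measurable_funPT (Lrepr f))).
Qed.

End Koopman.

(** The action is [f |-> (f + F) o rho g - F], which makes sense on [L^p] as soon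
    as the functions [F o rho g - F] are in [L^p], even when [F] is not; it is
    proper when their norms tend to infinity. *)
Section CocycleAction.
Context (R : realType) (G : groupType) d (T : measurableType d).
Variables (mu : {measure set T -> \bar R}) (r : R) (p1 : (1 <= r%:E)%E).
Variables (rho : G -> T -> T) (F : T -> R).
Hypothesis mrho : forall g, measurable_fun [set: T] (rho g).
Hypothesis rho_mu : forall g A, measurable A -> mu (rho g @^-1` A) = mu A.
Hypothesis rho1 : forall x, rho 1%g x = x.
Hypothesis rhoM : forall g h x, rho (g * h)%g x = rho h (rho g x).
Hypothesis mF : measurable_fun [set: T] F.
Hypothesis F_finite : forall g, finite_norm mu r%:E (fun x => F (rho g x) - F x).
Hypothesis F_proper :
  fine (Lnorm mu r%:E (EFin \o (fun x => F (rho g x) - F x)))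
    @[g --> @group_infinity G] --> +oo.

Local Notation Lf := (LfunType mu p1).
Local Notation Lp := (LspaceType mu p1).

Lemma coboundary_Lfun g : (fun x => F (rho g x) - F x) \in Lfun mu r%:E.
Proof.
apply/andP; split; rewrite inE//=.
by apply: measurable_funB => //; exact: measurableT_comp.
Qed.

Definition coboundary g : Lf := Lfun_Sub p1 (coboundary_Lfun g).

Definition cocycle_action g (f : Lp) : Lp :=
  koopman_class (mrho g) (rho_mu g) f + Lclass (coboundary g).

Lemma cocycle_action_proper : acts_properly_isometrically G Lp.
Proof.
exists cocycle_action; split; last first.
  exists 0; rewrite /cocycle_action.
  under eq_cvg do rewrite raddf0 add0r Lclass_norm.
  exact: F_proper.
split.
- move=> f; rewrite /cocycle_action -(LreprK f) koopman_classE -LclassD.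
  congr Lclass; apply/LfuneqP => x.
  change (Lrepr f (rho 1%g x) + (F (rho 1%g x) - F x) = Lrepr f x).
  by rewrite !rho1 subrr addr0.
- move=> g h f; rewrite /cocycle_action -(LreprK f) raddfD/= !koopman_classE.
  rewrite -(LclassD (koopman _ _ (koopman _ _ _))) -!LclassD.
  congr Lclass; apply/LfuneqP => x.
  change (Lrepr f (rho (g * h)%g x) + (F (rho (g * h)%g x) - F x) =
    Lrepr f (rho h (rho g x)) + (F (rho h (rho g x)) - F (rho g x))
      + (F (rho g x) - F x)).
  by rewrite !rhoM -addrA (addrA (_ - F (rho g x))) subrK.
- move=> g; split.
    exists (koopman_class (mrho g) (rho_mu g) (p1 := p1)).
    by exists (Lclass (coboundary g)).
  move=> u v; rewrite /cocycle_action opprD addrACA subrr addr0 -raddfB.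
  exact: koopman_class_norm.
Qed.

End CocycleAction.

(** * From Hilbert spaces to L^p *)

Section AffineExtension.
Context (R : realType) (H : normedModType R) (l : {linear H -> H}) (b : H).

(** The affine map [u |-> l u + b], placed on the slice of degree 1, extends to
    this additive map; on degree 0 it is the linear part [l]. *)
Definition affine_extension (u : (H * int)%type) : (H * int)%type :=
  (l u.1 + b *~ u.2, u.2).

Lemma affine_extension_is_zmod_morphism : zmod_morphism affine_extension.
Proof.
move=> u v; rewrite /affine_extension; congr pair => /=.
by rewrite raddfB mulrzBr opprD addrACA.
Qed.

HB.instance Definition _ :=
  GRing.isZmodMorphism.Build _ _ affine_extension affine_extension_is_zmod_morphism.

Lemma gaussian_affine_extension (dot : {dot H for idfun}) t u :
  (forall v, `|v| ^+ 2 = dot v v) -> (forall v, `|l v| = `|v|) ->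
  gaussian dot t u = gaussian dot t (affine_extension u).
Proof.
move=> dotE lE; rewrite /gaussian /=; case: eqP => [->|]; last by rewrite !mul0r.
by rewrite mulr0z addr0 -!dotE lE.
Qed.

End AffineExtension.

Section ProperAction.
Context (R : realType) (G : groupType) (H : normedModType R).
Context (dot : {dot H for idfun}) (alpha : G -> H -> H) (v0 : H).
Hypothesis dot_norm : forall v, `|v| ^+ 2 = dot v v.
Hypothesis alpha_action : affine_isometric_action alpha.
Hypothesis alpha_proper : `|alpha g v0| @[g --> @group_infinity G] --> +oo.
Local Notation P := (@unit_lebesgue R).
Local Notation I := (G * nat)%type.

Definition orbit_vector (i : I) : (H * int)%type := (alpha i.1 v0, 1).

Definition left_translation (h : G) (i : I) : I := ((h * i.1)%g, i.2).

Lemma left_translationK h :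
  cancel (left_translation h) (left_translation h^-1%g).
Proof. by case=> g j; rewrite /left_translation/= mulKg. Qed.

(** The Gaussian only sees the degree 0, where an affine isometry acts by its
    linear isometric part. *)
Lemma orbit_symmetry h : exists lambda : {additive H * int -> H * int},
  (forall i, lambda (orbit_vector i) = orbit_vector (left_translation h i)) /\
  (forall t u, gaussian dot t u = gaussian dot t (lambda u)).
Proof.
case: alpha_action => _ alphaM /(_ h)[[l [b lE]] iso].
have l_norm v : `|l v| = `|v|.
  by have := iso v 0; rewrite !lE raddf0 add0r addrK subr0.
exists (affine_extension l b); split=> [i|t u].
  by rewrite /affine_extension /orbit_vector /= alphaM lE.
exact: gaussian_affine_extension.
Qed.

Definition scale n : R := 4^-1 ^+ n.

Lemma scale_ge0 n : 0 <= scale n. Proof. by rewrite exprn_ge0. Qed.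

Variable Y : nat -> I -> measurableTypeR R -> bool.
Hypothesis YL : forall n, has_bit_law (gaussian dot (scale n)) orbit_vector (Y n).

Let mY n i : measurable_fun setT (Y n i). Proof. exact: (YL n).1. Qed.

Local Notation T := (bit_space I).
Local Notation mu := (bit_measure mY).

Definition translation (h : G) : T -> T := relabel (left_translation h).

Lemma translation_measure h A : measurable A -> mu (translation h @^-1` A) = mu A.
Proof.
move=> mA; apply: bit_measure_relabel => // n l.
have [lambda [lv lphi]] := orbit_symmetry h.
exact: (bit_law_invariant (YL n) _ (left_translationK h) (lphi _) lv).
Qed.

(** In the [n]-th copy the parameter of the Gaussian is [scale n], which tends to
    zero, and the number [4 ^ n] of samples tends to infinity, so that the
    increments of this function under a given translation become small. *)
Definition bit_average (x : T) : R :=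
  (\sum_(j < 4 ^ x.1) sg R (x.2 (1%g, val j))) / (4 ^ x.1)%:R.

Lemma measurable_bit_average : measurable_fun setT bit_average.
Proof.
rewrite (_ : setT = \bigcup_n (cylinder n [::] : set T)); last first.
  by apply/seteqP; split => // x _; exists x.1.
apply/measurable_fun_bigcup => n; first exact: measurable_cylinder.
apply: (eq_measurable_fun (fun x : T =>
    (\sum_(j < 4 ^ n) sg R (x.2 (1%g, val j))) / (4 ^ n)%:R)).
  by move=> x; rewrite inE => -[<- _].
apply: measurable_funTS; apply: measurable_funM => //.
apply: measurable_sum => j; rewrite /sg; apply: measurable_fun_ifT => //.
apply: (measurable_fun_bool true); rewrite setTI.
rewrite (_ : _ @^-1` _ = \bigcup_m (cylinder m [:: ((1%g, val j), true)] : set T)).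
  by apply: bigcupT_measurable => m; exact: measurable_cylinder.
apply/seteqP; split => x /=.
  by move=> xj; exists x.1 => //; split=> // c; rewrite inE => /eqP ->.
by move=> [m _ [_ /(_ ((1%g, val j), true))]]; apply; rewrite mem_head.
Qed.

Definition increment h (x : T) : R := bit_average (translation h x) - bit_average x.

Lemma measurable_increment h : measurable_fun setT (increment h).
Proof.
apply: measurable_funB; last exact: measurable_bit_average.
by apply: measurableT_comp; [exact: measurable_bit_average|exact: measurable_relabel].
Qed.

Lemma increment_bit_map h n y :
  increment h (bit_map Y n y) =
  (\sum_(j < 4 ^ n) (bit_sign (Y n) (h, val j) y - bit_sign (Y n) (1%g, val j) y))
    / (4 ^ n)%:R.
Proof.
rewrite /increment /bit_average /= -mulrBl -sumrB.
by congr (_ / _); apply: eq_bigr => j _; rewrite /left_translation /= mulg1.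
Qed.

Lemma bit_average_norm x : `|bit_average x| <= 1.
Proof.
rewrite /bit_average normrM normfV normr_nat ler_pdivrMr; last first.
  by rewrite ltr0n expn_gt0.
rewrite mul1r (le_trans (ler_norm_sum _ _ _))//.
rewrite (eq_bigr (fun=> 1)) ?sumr_const ?card_ord// => j _.
by rewrite /sg; case: ifP => _; rewrite ?normrN normr1.
Qed.

Lemma increment_norm h x : `|increment h x| <= 2.
Proof.
rewrite /increment (le_trans (ler_normB _ _))//.
by have := bit_average_norm (translation h x); have := bit_average_norm x; lra.
Qed.

Local Notation dist h := (`|alpha h v0 - alpha 1%g v0|).

Lemma increment_variance h n : h != 1%g ->
  \int[P]_y (increment h (bit_map Y n y)) ^+ 2 =
  1 - expR (- (scale n * dist h ^+ 2)) + scale n.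
Proof.
move=> h1; under eq_Rintegral do rewrite increment_bit_map.
pose a (b : bool) (j : 'I_(4 ^ n)) : I := (if b then h else 1%g, val j).
pose w (b : bool) : (H * int)%type := (alpha (if b then h else 1%g) v0, 1).
have gN u : gaussian dot (scale n) (- u) = gaussian dot (scale n) u.
  by rewrite /gaussian /= oppr_eq0 -(scaleN1r u.1) dotZZ mulrNN !mul1r.
rewrite (@bit_average_variance _ _ _ _ _ _ (YL n) gN _ (4 ^ n) a w)//.
- rewrite /gaussian /= mul1r -dot_norm; congr (_ + _).
  by rewrite /scale natrX exprVn.
- by move=> i j; rewrite /gaussian /= mul0r.
- by rewrite expn_gt0.
- move=> b c j k; rewrite /a xpair_eqE; congr (_ && _).
  by case: b; case: c; rewrite ?eqxx// ?(negPf h1) 1?eq_sym ?(negPf h1).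
- exact: gaussian0.
Qed.

Variables (p : R) (p1 : (1 <= p%:E)%E).
Let p1' : 1 <= p. Proof. by rewrite -lee_fin. Qed.

Let measurable_increment_bit_map h n :
  measurable_fun setT (fun y => increment h (bit_map Y n y)).
Proof.
by apply: measurableT_comp; [exact: measurable_increment|exact: measurable_bit_map].
Qed.

Local Notation moment h n := (\int[P]_y (`|increment h (bit_map Y n y)| `^ p)%:E)%E.

Lemma translation1 x : translation 1%g x = x.
Proof.
case: x => n w; rewrite /translation /relabel /=; congr pair.
by apply/funext => -[g j]; rewrite /= /left_translation /= mul1g.
Qed.

Lemma translationM g h x : translation (g * h)%g x = translation h (translation g x).
Proof.
case: x => n w; rewrite /translation /relabel /=; congr pair.
by apply/funext => -[k j]; rewrite /= /left_translation /= mulgA.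
Qed.

Lemma increment1 x : increment 1%g x = 0.
Proof.
by rewrite /increment translation1 subrr.
Qed.

(** The variance is of order [4^-n], and the order [2^-n] comes from
    [moment_le] with parameter [2^-n]. *)
Lemma increment_moment_le h n :
  (moment h n <= (2 `^ p * (2 + dist h ^+ 2) * 2^-1 ^+ n)%:E)%E.
Proof.
have [->|h1] := eqVneq h 1%g.
  under eq_integral do rewrite increment1 normr0 powR0 ?gt_eqF ?(lt_le_trans ltr01)//.
  by rewrite integral0 lee_fin mulr_ge0 ?exprn_ge0// mulr_ge0 ?powR_ge0//.
have e0 : 0 < 2^-1 ^+ n :> R by rewrite exprn_gt0.
apply: (le_trans (moment_le P p1' (measurable_increment_bit_map h n) _ e0)).
  by move=> y; exact: increment_norm.
rewrite increment_variance// lee_fin -mulrA ler_wpM2l ?powR_ge0//.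
have -> : scale n = 2^-1 ^+ n * 2^-1 ^+ n.
  by rewrite /scale -exprMn; congr (_ ^+ n); field.
set e := 2^-1 ^+ n; set c := dist h ^+ 2.
have ex := expR_ge1Dx (- (e * e * c)).
rewrite (_ : (2 + c) * e = e + (e * e * c + e * e) / e); last first.
  by field; rewrite gt_eqF.
by rewrite lerD2l ler_wpM2r ?invr_ge0 ?(ltW e0)//; lra.
Qed.

(** On the copies where [h] moves the orbit far at scale [n], the variance is at
    least [1 - exp(-1) >= 1/2]. *)
Lemma increment_moment_ge h n : 1 <= scale n * dist h ^+ 2 ->
  (((16 * 2 `^ p)^-1)%:E <= moment h n)%E.
Proof.
move=> far; have h1 : h != 1%g.
  by apply: contraTneq far => ->; rewrite subrr normr0 expr0n/= mulr0 -ltNge.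
apply: le_trans (moment_ge P p1' (measurable_increment_bit_map h n) _); last first.
  by move=> y; exact: increment_norm.
rewrite increment_variance// lee_fin.
have : expR (- (scale n * dist h ^+ 2)) <= 2^-1.
  rewrite expRN lef_pV2 ?posrE ?expR_gt0//.
  by apply: le_trans (expR_ge1Dx _); lra.
have s0 := scale_ge0 n; move=> e2.
have -> : (16 * 2 `^ p)^-1 = 4^-1 / (4 * 2 `^ p) :> R.
  by field; rewrite gt_eqF ?powR_gt0.
by rewrite ler_wpM2r ?invr_ge0 ?mulr_ge0 ?powR_ge0//; lra.
Qed.

Lemma increment_Lnorm h :
  (Lnorm mu p%:E (EFin \o increment h) `^ p =
   \sum_(0 <= n <oo) moment h n)%E.
Proof.
rewrite poweR_Lnorm ?gt_eqF ?(lt_le_trans ltr01)//.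
rewrite ge0_integral_bit_measure//.
- apply/measurable_EFinP; apply: (measurableT_comp (measurable_powR _)) => //.
  apply: measurableT_comp => //; exact: measurable_increment.
- by move=> x; rewrite lee_fin powR_ge0.
Qed.

(** The moments of the copies decrease geometrically. *)
Lemma increment_finite h : finite_norm mu p%:E (increment h).
Proof.
have p0 : p != 0 by rewrite gt_eqF// (lt_le_trans ltr01).
apply: (lty_poweRy p0); rewrite increment_Lnorm.
pose C := 2 `^ p * (2 + dist h ^+ 2).
have C0 : 0 <= C by rewrite mulr_ge0 ?powR_ge0// addr_ge0 ?exprn_ge0.
apply: (@le_lt_trans _ _ (\sum_(0 <= n <oo) (0 + (C * 2 / (2 ^ n.+1)%:R)%:E))%E).
  apply: lee_nneseries => n _.
    by move=> _; apply: integral_ge0 => y _; rewrite lee_fin powR_ge0.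
  rewrite add0e; apply: le_trans (increment_moment_le h n) _.
  rewrite lee_fin -/C -mulrA ler_wpM2l// natrX exprS exprVn invfM mulrA divff//.
  by rewrite mul1r.
apply: le_lt_trans (epsilon_trick xpredT _ _) _ => //; first by rewrite mulr_ge0.
by rewrite eseries0// add0e ltry.
Qed.

Lemma group_infinity_filter : Filter (@group_infinity G).
Proof.
split=> [|A B|A B]; rewrite /group_infinity.
- exact: cofinite_setT.
- by move=> cA cB; rewrite /= cofinite_setI.
- exact: sub_cofinite_set.
Qed.

(** If [h] moves the base point by at least [2 ^ N], then each of the first [N]
    copies contributes at least the constant of [increment_moment_ge]. *)
Lemma increment_proper :
  fine (Lnorm mu p%:E (EFin \o increment h)) @[h --> @group_infinity G] --> +oo.
Proof.
have FI := group_infinity_filter.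
have p0 : 0 < p by rewrite (lt_le_trans ltr01).
apply/cvgryPge => A.
pose k : R := (16 * 2 `^ p)^-1.
have k0 : 0 < k by rewrite invr_gt0 mulr_gt0 ?powR_gt0.
have [N AN] : exists N : nat, `|A| `^ p <= N%:R * k.
  exists (Num.bound (`|A| `^ p / k)).
  by rewrite -ler_pdivrMr// ltW// archi_boundP// divr_ge0 ?powR_ge0// ltW.
move/cvgryPge: alpha_proper => /(_ (2 ^+ N + `|alpha 1%g v0|)).
apply: filterS => h far.
have dist_ge : 2 ^+ N <= dist h.
  by apply: le_trans (lerB_dist _ _); rewrite lerBrDr.
have Lfin : Lnorm mu p%:E (EFin \o increment h) \is a fin_num.
  by rewrite ge0_fin_numE ?Lnorm_ge0//; exact: increment_finite.
set L := fine _; have L0 : 0 <= L by rewrite fine_ge0 ?Lnorm_ge0.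
have : ((`|A| `^ p)%:E <= (L `^ p)%:E)%E.
  rewrite -[X in (_ <= X)%E]poweR_EFin /L fineK// increment_Lnorm.
  apply: (@le_trans _ _ (\sum_(0 <= n < N) moment h n)%E); last first.
    apply: nneseries_lim_ge => n _ _.
    by apply: integral_ge0 => y _; rewrite lee_fin powR_ge0.
  apply: (@le_trans _ _ (\sum_(0 <= n < N) k%:E)%E).
    by rewrite sumEFin lee_fin big_const_nat subn0 iter_addr_0 -mulr_natl.
  rewrite !big_nat; apply: lee_sum => n /andP[_ nN].
  apply: increment_moment_ge.
  have : 4 ^+ n <= dist h ^+ 2.
    apply: (@le_trans _ _ ((2 ^+ N) ^+ 2)); last by rewrite lerXn2r ?nnegrE ?exprn_ge0.
    rewrite -exprM mulnC exprM (_ : 2 ^+ 2 = 4); last by ring.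
    by apply: ler_weXn2l; [rewrite ler1n|exact: ltnW].
  by rewrite /scale exprVn mulrC ler_pdivlMr ?exprn_gt0// mul1r.
rewrite lee_fin => AL; apply: le_trans (ler_norm A) _.
rewrite leNgt; apply/negP => LA; move: AL; rewrite leNgt => /negP; apply.
by rewrite gt0_ltr_powR ?nnegrE.
Qed.

Lemma proper_Lp_action : acts_properly_on_some_Lp G p1.
Proof.
exists _, T, mu; apply: (@cocycle_action_proper _ _ _ _ mu p p1 translation bit_average).
- by move=> h; exact: measurable_relabel.
- exact: translation_measure.
- exact: translation1.
- exact: translationM.
- exact: measurable_bit_average.
- exact: increment_finite.
- exact: increment_proper.
Qed.

End ProperAction.

Lemma a_T_menable_acts_properly_on_some_Lp (R : realType) (G : groupType)
    (p : R) (p1 : (1 <= p%:E)%E) :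
  countable [set: G] -> a_T_menable R G -> acts_properly_on_some_Lp G p1.
Proof.
move=> cG [H [[dot dotE] [alpha [act [v0 proper]]]]].
have cI : countable [set: G * nat].
  by rewrite -setXTT; apply: countableX.
have /choice[Y YL] n : exists Y,
    has_bit_law (gaussian dot (scale R n)) (orbit_vector alpha v0) Y.
  apply: bit_family_exists => //.
  - exact: (1%g, 0%N).
  - by apply: gaussian_pos_def; exact: scale_ge0.
  - exact: gaussian0.
exact: (proper_Lp_action dotE act proper YL p1).
Qed.


(** * Completeness and the inner product of L^2 *)

Section RieszFischer.
Context d (T : measurableType d) (R : realType).
Variables (mu : {measure set T -> \bar R}).
Local Notation "''N' f" := (Lnorm mu 2%:E (EFin \o f%R)) (at level 10, f at level 8).

Let measurable_sqr (f : T -> R) : measurable_fun [set: T] f ->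
  measurable_fun [set: T] (fun x => (f x ^+ 2)%:E).
Proof. by move=> mf; apply/measurable_EFinP; exact: measurable_funX. Qed.

Lemma Lnorm2_leP (f : T -> R) c : 0 <= c ->
  ('N f <= c%:E)%E <-> (\int[mu]_x (f x ^+ 2)%:E <= (c ^+ 2)%:E)%E.
Proof.
move=> c0; have sqrE : (\int[mu]_x `|(EFin \o f) x| `^ 2 = \int[mu]_x (f x ^+ 2)%:E)%E.
  apply: eq_integral => x _ /=.
  by rewrite powR_mulrn// real_normK ?num_real.
have int_ge0 : (0 <= \int[mu]_x (f x ^+ 2)%:E)%E.
  by apply: integral_ge0 => x _; rewrite lee_fin sqr_ge0.
have c2E : (c ^+ 2)%:E = (c%:E `^ 2)%E by rewrite poweR_EFin powR_mulrn.
rewrite c2E; split=> [Nc|ic].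
  rewrite -sqrE -poweR_Lnorm//.
  by apply: gt0_ler_poweR; rewrite ?in_itv/= ?Lnorm_ge0 ?lee_fin ?leey ?andbT.
have {1}-> : c%:E = ((c%:E `^ 2) `^ 2^-1)%E.
  by rewrite -poweRrM mulfV// poweRe1 ?lee_fin.
rewrite unlock /Lnorm sqrE.
apply: gt0_ler_poweR; rewrite ?in_itv/= ?invr_ge0 ?leey ?andbT ?int_ge0//.
by rewrite lee_fin powR_ge0.
Qed.

Let Lnorm2_leD (f g : T -> R) a b : measurable_fun [set: T] f ->
  measurable_fun [set: T] g -> ('N f <= a%:E)%E -> ('N g <= b%:E)%E ->
  ('N (f \+ g) <= (a + b)%:E)%E.
Proof.
move=> mf mg fa gb.
apply: (le_trans (eminkowski mu mf mg (lee1n 2))).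
by rewrite EFinD leeD.
Qed.

Lemma Lnorm_fatou (h : nat -> T -> R) (l : T -> R) c : 0 <= c ->
  (forall n, measurable_fun [set: T] (h n)) ->
  (forall x, h n x @[n --> \oo] --> l x) ->
  (forall n, 'N (h n) <= c%:E)%E -> ('N l <= c%:E)%E.
Proof.
move=> c0 mh hl hc; apply/Lnorm2_leP => //.
have cvgE x : (h n x ^+ 2)%:E @[n --> \oo] --> (l x ^+ 2)%:E.
  by apply/fine_cvgP; split; [exact: nearW|apply: cvgM; exact: hl].
under eq_integral => x _ do rewrite -(cvg_limn_einf_sup (cvgE x)).1.
apply: le_trans (fatou _ _ _ _) _ => //.
- by move=> n; exact: measurable_sqr.
- by move=> n x _; rewrite lee_fin sqr_ge0.
rewrite limn_einf_lim; apply: lime_le; first exact: is_cvg_einfs.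
apply: nearW => n; apply: (@le_trans _ _ (\int[mu]_x (h n x ^+ 2)%:E)%E).
  by apply: ereal_inf_lbound; exists n => /=.
exact/Lnorm2_leP.
Qed.

(** The function-level form of the Riesz-Fischer theorem. The sums [G n] of the
    absolute increments of [f] are bounded in norm by 2, so that by monotone
    convergence their limit is finite almost everywhere; there [f] converges,
    and Fatou's lemma bounds the distance to the limit. *)
Lemma Lnorm_cauchy_limit (f : nat -> T -> R) :
  (forall n, measurable_fun [set: T] (f n)) ->
  (forall n, 'N (f n.+1 \- f n) <= (2^-1 ^+ n)%:E)%E ->
  exists l : T -> R, measurable_fun [set: T] l /\
    forall n, ('N (l \- f n) <= (2 * 2^-1 ^+ n)%:E)%E.
Proof.
move=> mf hf.
have half_ge0 n : 0 <= 2^-1 ^+ n :> R by rewrite exprn_ge0.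
have tail n k : ('N (f (k + n)%N \- f n) <= (2 * 2^-1 ^+ n - 2 * 2^-1 ^+ (k + n))%:E)%E.
  elim: k => [|k IH].
    rewrite add0n addrN (_ : f n \- f n = cst 0); last by apply/funext => x /=; rewrite subrr.
    by rewrite Lnorm0//.
  have -> : f (k.+1 + n)%N \- f n = (f (k + n).+1 \- f (k + n)%N) \+ (f (k + n)%N \- f n).
    by apply/funext => x /=; rewrite addrA subrK.
  rewrite addSn exprS (_ : _ - _ = 2^-1 ^+ (k + n) +
    (2 * 2^-1 ^+ n - 2 * 2^-1 ^+ (k + n))); last by field.
  by apply: Lnorm2_leD => //; exact: measurable_funB.
pose G n x := \sum_(0 <= i < n) `|f i.+1 x - f i x|.
have mG n : measurable_fun [set: T] (G n).
  apply: measurable_sum => i; apply: measurableT_comp => //.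
  exact: measurable_funB.
have NG n : ('N (G n) <= (2 - 2 * 2^-1 ^+ n)%:E)%E.
  elim: n => [|n IH].
    rewrite (_ : G 0%N = cst 0); last by apply/funext => x; rewrite /G big_nil.
    by rewrite Lnorm0// lee_fin expr0 mulr1 subrr.
  have -> : G n.+1 = G n \+ (fun x => `|(f n.+1 \- f n) x|).
    by apply/funext => x /=; rewrite /G big_nat_recr.
  have h : ('N (fun x => `|(f n.+1 \- f n) x|) <= (2^-1 ^+ n)%:E)%E.
    apply: le_trans (hf n); rewrite -[X in (_ <= X)%E]Lnorm_abse.
    by rewrite le_eqVlt; apply/orP; left; apply/eqP; apply: eq_Lnorm.
  rewrite exprS (_ : _ - _ = 2 - 2 * 2^-1 ^+ n + 2^-1 ^+ n); last by field.
  apply: Lnorm2_leD => //.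
  by apply: measurableT_comp => //; exact: measurable_funB.
have G_ge0 n x : 0 <= G n x by apply: sumr_ge0.
have Gnd x : nondecreasing_seq (G ^~ x).
  by apply/nondecreasing_seqP => n; rewrite /G big_nat_recr//= lerDl.
pose g n x := (G n x ^+ 2)%:E.
have mg n : measurable_fun [set: T] (g n) by exact: measurable_sqr.
have g_ge0 n x : (0 <= g n x)%E by rewrite lee_fin sqr_ge0.
have gnd x : {homo g ^~ x : n m / (n <= m)%N >-> (n <= m)%E}.
  by move=> n m nm; rewrite lee_fin lerXn2r ?nnegrE//; exact: Gnd.
pose gl x := limn (g ^~ x).
have mgl : measurable_fun [set: T] gl.
  apply: (emeasurable_fun_cvg g) => // x _.
  exact: ereal_nondecreasing_is_cvgn.
have gl_ge0 x : (0 <= gl x)%E.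
  by apply: lime_ge; [exact: ereal_nondecreasing_is_cvgn|exact: nearW].
have int_gl : (\int[mu]_x gl x < +oo)%E.
  rewrite (monotone_convergence mu measurableT mg)//.
  apply: (@le_lt_trans _ _ (2 ^+ 2)%:E); last exact: ltry.
  apply: lime_le.
    apply: ereal_nondecreasing_is_cvgn => n m nm.
    by apply: ge0_le_integral => // x _; exact: gnd.
  apply: nearW => n; apply/Lnorm2_leP => //; apply: le_trans (NG n) _.
  by rewrite lee_fin gerBl mulr_ge0.
have igl : mu.-integrable [set: T] gl.
  apply/integrableP; split => //; apply: le_lt_trans int_gl.
  by rewrite le_eqVlt; apply/orP; left; apply/eqP; apply: eq_integral => x _; rewrite gee0_abs.
pose A := [set x | (gl x < +oo)%E].
have mA : measurable A.
  by rewrite -[A]setTI; exact: emeasurable_fun_infty_o.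
have Aae : {ae mu, forall x, A x}.
  apply: filterS (integrable_ae measurableT igl) => x /(_ I) gx.
  by rewrite /A /= -ge0_fin_numE.
have cvgf x : A x -> cvgn (f ^~ x).
  move=> Ax; have : cvgn [normed series (telescope (f ^~ x))].
    apply: nondecreasing_is_cvgn.
      exact: (Gnd x).
    have [M glM] : exists M, gl x = M%:E.
      by exists (fine (gl x)); rewrite fineK// ge0_fin_numE.
    exists (Num.max 1 M) => _ [n _ <-].
    change (G n x <= Num.max 1 M).
    rewrite le_max; have [//|G1] := leP (G n x) 1.
    apply/orP; right; rewrite (le_trans (ler_eXnr (n := 2) _ (ltW G1)))//.
    rewrite -lee_fin -glM.
    apply: lime_ge; first exact: ereal_nondecreasing_is_cvgn.
    by exists n => // m /= nm; exact: gnd.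
  move=> /normed_cvg; rewrite telescopeK => c.
  have /cvg_ex[/= l cl] := c; apply/cvg_ex; exists (l + f 0%N x).
  rewrite (_ : f ^~ x = fun n => (f n x - f 0%N x) + f 0%N x).
    by apply: cvgD => //; exact: cvg_cst.
  by apply/funext => n; rewrite subrK.
(* [h n] equals [f n] almost everywhere and converges everywhere *)
pose h n x := \1_A x * f n x.
have mh n : measurable_fun [set: T] (h n) by apply: measurable_funM => //; exact: measurable_indic.
have cvgh x : h n x @[n --> \oo] --> limn (h ^~ x).
  have [Ax|Ax] := pselect (A x).
    rewrite (_ : h ^~ x = f ^~ x); first exact: cvgf.
    by apply/funext => n; rewrite /h indicE mem_set// mul1r.
  rewrite (_ : h ^~ x = cst 0); first exact: is_cvg_cst.
  by apply/funext => n; rewrite /h indicE memNset// mul0r.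
have ml : measurable_fun [set: T] (fun x => limn (h ^~ x)).
  exact: (measurable_fun_cvg mh).
exists (fun x => limn (h ^~ x)); split=> // n.
have hB k : 'N (h k \- f n) = 'N (f k \- f n).
  apply: (ae_eq_Lnorm (lee1n 2)).
  - by apply/measurable_EFinP; exact: measurable_funB.
  - by apply/measurable_EFinP; exact: measurable_funB.
  - by apply: filterS Aae => x Ax _; rewrite /h /= indicE mem_set// mul1r.
apply: (@Lnorm_fatou (fun k => h (k + n)%N \- f n)).
- by rewrite mulr_ge0.
- by move=> k; exact: measurable_funB.
- move=> x; apply: cvgB; last exact: cvg_cst.
  by rewrite (cvg_shiftn n (h ^~ x)); exact: cvgh.
- move=> k; rewrite hB; apply: le_trans (tail n k) _.
  by rewrite lee_fin gerBl mulr_ge0.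
Qed.
End RieszFischer.

Section L2Hilbert.
Context d (T : measurableType d) (R : realType).
Variables (mu : {measure set T -> \bar R}) (p1 : (1 <= (2 : R)%:E)%E).
Local Notation Lf := (LfunType mu p1).
Local Notation L2 := (LspaceType mu p1).

Lemma LclassB (f g : Lf) : Lclass f - Lclass g = Lclass (f - g).
Proof. by rewrite -scaleN1r -LclassZ -LclassD scaleN1r. Qed.

Lemma Lnorm_Lclass (f : Lf) : (`|Lclass f|%:E = Lnorm mu 2%:E (EFin \o f))%E.
Proof. by rewrite Lclass_norm -finite_norm_fine. Qed.

Lemma L2_complete (F : set_system L2) : ProperFilter F -> cauchy F -> cvg F.
Proof.
move=> FF /cauchyP Fc.
have half_gt0 n : 0 < 2^-1 ^+ n :> R by rewrite exprn_gt0.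
have /choice[u Fu] n : exists x : L2, F (ball x (2^-1 ^+ n.+2)) by exact: Fc.
have uS n : `|u n.+1 - u n| <= 2^-1 ^+ n.
  have [y [h1 h2]] := @filter_ex _ F _ _ (filterI (Fu n.+1) (Fu n)).
  move: h1 h2; rewrite -ball_normE /ball_/= => h1 h2.
  rewrite (le_trans (ler_distD y _ _))//; move: h1 h2; rewrite (distrC (u n)).
  by rewrite !exprS; have := half_gt0 n; lra.
pose f n : T -> R := Lrepr (u n).
have mf n : measurable_fun [set: T] (f n).
  exact: (measurable_funPT (Lrepr (u n))).
have [l [ml lf]] : exists l : T -> R, measurable_fun [set: T] l /\
    forall n, (Lnorm mu 2%:E (EFin \o (l \- f n)%R) <= (2 * 2^-1 ^+ n)%:E)%E.
  apply: Lnorm_cauchy_limit => // n.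
  have := uS n; rewrite -lee_fin -{1}(LreprK (u n.+1)) -{1}(LreprK (u n)).
  by rewrite LclassB Lnorm_Lclass.
have lL : l \in Lfun mu 2%:E.
  apply/andP; split; rewrite inE//= /finite_norm.
  rewrite (_ : l = (l \- f 0%N) \+ f 0%N); last by apply/funext => x /=; rewrite subrK.
  apply: (le_lt_trans (eminkowski mu (measurable_funB ml (mf 0%N)) (mf 0%N) (lee1n 2))).
  apply: lte_add_pinfty; first exact: le_lt_trans (lf 0%N) (ltry _).
  exact: (Lfunction_finite p1 (Lrepr (u 0%N))).
pose L : L2 := Lclass (Lfun_Sub p1 lL).
have Lu n : `|L - u n| <= 2 * 2^-1 ^+ n.
  rewrite -lee_fin -(LreprK (u n)) LclassB Lnorm_Lclass.
  exact: lf.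
apply/cvg_ex; exists L; apply/cvg_ballP => e e0.
have [n ne] : exists n, 3 * 2^-1 ^+ n < e.
  have : 3 * 2^-1 ^+ n @[n --> \oo] --> (3 * 0 : R).
    by apply: cvgMl_tmp; apply: cvg_expr; rewrite ger0_norm ?invr_ge0//; lra.
  rewrite mulr0 => /cvgr_lt/(_ e e0)[n _ /(_ n (leqnn n)) ne].
  by exists n.
apply: filterS (Fu n) => y; rewrite -ball_normE /ball_/= => uy.
rewrite (le_lt_trans (ler_distD (u n) _ _))//.
have := Lu n; move: uy; rewrite !exprS; have := half_gt0 n; lra.
Qed.

HB.instance Definition _ := Uniform_isComplete.Build L2 L2_complete.

Definition L2_dot (f g : L2) : R := \int[mu]_x (Lrepr f x * Lrepr g x).

Lemma L2_mul_integrable (f g : Lf) :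
  mu.-integrable [set: T] (EFin \o (fun x => f x * g x)).
Proof.
by apply/Lfun1_integrable; apply: (@Lfun2_mul_Lfun1 _ _ _ _ f g); exact: LfunP.
Qed.

Lemma L2_dotE (f g : Lf) :
  L2_dot (Lclass f) (Lclass g) = \int[mu]_x (f x * g x).
Proof.
rewrite /L2_dot /Rintegral; congr fine; apply: ae_eq_integral => //.
- exact: (measurable_int _ (L2_mul_integrable (Lrepr (Lclass f)) (Lrepr (Lclass g)))).
- exact: (measurable_int _ (L2_mul_integrable f g)).
- have := LclassK_ae g; have := LclassK_ae f.
  by apply: filterS2 => x /(_ I) fx /(_ I) gx _; rewrite fx gx.
Qed.

Lemma L2_dotC f g : L2_dot f g = L2_dot g f.
Proof. by apply: eq_Rintegral => x _; rewrite mulrC. Qed.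

Lemma L2_dot_linear f : linear_for *%R (L2_dot f).
Proof.
move=> a g h; rewrite -(LreprK f) -(LreprK g) -(LreprK h) -LclassZ -LclassD !L2_dotE.
rewrite -RintegralZl//; last exact: L2_mul_integrable.
rewrite -RintegralD//; first last.
- exact: L2_mul_integrable.
- rewrite (_ : _ \o _ = EFin \o (fun x => (Lrepr f) x * (a *: Lrepr g : Lf) x)).
    exact: L2_mul_integrable.
  by apply/funext => x /=; rewrite mulrCA.
apply: eq_Rintegral => x _.
change (Lrepr f x * (a * Lrepr g x + Lrepr h x) =
  a * (Lrepr f x * Lrepr g x) + Lrepr f x * Lrepr h x).
by ring.
Qed.

Lemma L2_dot_bilinear : bilinear_for *%R (idfun \; *%R) L2_dot.
Proof.
split=> [f a g h|f]; last exact: L2_dot_linear.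
by rewrite !(L2_dotC _ f) L2_dot_linear.
Qed.

Lemma L2_dot_hermitian f g : L2_dot f g = (-1) ^+ false * idfun (L2_dot g f).
Proof. by rewrite expr0 mul1r L2_dotC. Qed.

Lemma L2_dot_norm f : `|f| ^+ 2 = L2_dot f f.
Proof.
rewrite -(LreprK f) L2_dotE; apply: EFin_inj.
rewrite /Rintegral fineK; last first.
  by apply: integrable_fin_num => //; exact: L2_mul_integrable.
rewrite -powR_mulrn// -poweR_EFin Lnorm_Lclass poweR_Lnorm//.
apply: eq_integral => x _ /=.
by rewrite powR_mulrn// real_normK ?num_real// expr2.
Qed.

Lemma L2_dot_gt0 f : f != 0 -> 0 < L2_dot f f.
Proof. by move=> f0; rewrite -L2_dot_norm exprn_gt0// normr_gt0. Qed.

HB.instance Definition _ := bilinear_isBilinear.Build R L2 L2 R *%R (idfun \; *%R)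
  L2_dot L2_dot_bilinear.
HB.instance Definition _ := isHermitianSesquilinear.Build R L2 false idfun
  L2_dot L2_dot_hermitian.
HB.instance Definition _ := isDotProduct.Build R L2 L2_dot L2_dot_gt0.

Lemma L2_hilbert : hilbert_space L2.
Proof. by exists L2_dot; exact: L2_dot_norm. Qed.

End L2Hilbert.

Lemma L2_action_a_T_menable (R : realType) (G : groupType)
    (p1 : (1 <= (2 : R)%:E)%E) :
  acts_properly_on_some_Lp G p1 -> a_T_menable R G.
Proof.
move=> [d [T [mu act]]]; exists (LspaceType mu p1); split=> //.
exact: L2_hilbert.
Qed.

Theorem proposition3p1 (R : realType) (G : groupType)
    (hG : countable [set: G]) :
  a_T_menable R G <->
  (forall (p : R) (p1 : (1 <= p%:E)%E), acts_properly_on_some_Lp G p1).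
Proof.
split=> [aT p p1|Lp]; first exact: a_T_menable_acts_properly_on_some_Lp.
exact: L2_action_a_T_menable (Lp 2 (lee1n 2)).
Qed.
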